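(* Let $N_+=N+1$, let $\xi_1,\dots,\xi_n$ be nonrandom vectors in $\mathbb R^{N_+}$, let $\gamma=(\gamma_0,\gamma_1,\dots,\gamma_N)\in\mathbb R^{N_+}$ be fixed, put $\lambda_i=\xi_i'\gamma$ and $\mathbb Q=\otimes_{i\le n}Q_{\lambda_i}$, so that under $\mathbb Q$ the coordinate maps $y_1,\dots,y_n$ are independent with $y_i\sim Q_{\lambda_i}$. Let $\widehat g$ be the maximum likelihood estimator, i.e. the maximizer over $g\in\mathbb R^{N_+}$ of $$L_n(g)=\sum_{i\le n}\left[(\xi_i'g)y_i-\psi(\xi_i'g)\right].$$ Suppose $\xi_i=D\eta_i$ for $i=1,\dots,n$, for some nonsingular matrix $D$, and let $A_n=\frac1n\sum_{i\le n}\eta_i\eta_i'\ddot\psi(\lambda_i)$. Suppose $B_n$ is another nonsingular matrix for which $$\|A_n-B_n\|_2\le\left(2\|B_n^{-1}\|_2\right)^{-1},$$ and suppose that, for some $0<\epsilon<1$, $$\max_{i\le n}|\eta_i|\le\frac{\epsilon\sqrt n/N_+}{G(1)\sqrt{32\,\|B_n^{-1}\|_2}} .$$ Then for each set of vectors $\kappa_0,\dots,\kappa_M$ in $\mathbb R^{N_+}$ there is a set $\mathcal Y_{\kappa,\epsilon}$ with $\mathbb Q\,\mathcal Y_{\kappa,\epsilon}^c<2\epsilon$ on which $$\sum_{0\le j\le M}|\kappa_j'(\widehat g-\gamma)|^2\le\frac{6\|B_n^{-1}\|_2}{n\epsilon}\sum_{0\le j\le M}|D^{-1}\kappa_j|^2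 .$$
   Context: $\{Q_\lambda:\lambda\in\mathbb R\}$ is a one-parameter exponential family of probability measures on $\mathbb R$ with $dQ_\lambda/dQ_0=\exp(\lambda y-\psi(\lambda))$ for all $\lambda\in\mathbb R$, so $\psi(0)=0$ and $Q_\lambda$ has mean $\dot\psi(\lambda)$ and variance $\ddot\psi(\lambda)$; it is assumed that $\ddot\psi(\lambda)>0$ for all real $\lambda$. Regularity condition: there is an increasing real function $G$ on $\mathbb R^+$, with $G(0)\ge1$, such that $|\dddot\psi(\lambda+h)|\le\ddot\psi(\lambda)G(|h|)$ for all $\lambda,h\in\mathbb R$. $|v|$ is the Euclidean norm of a vector $v$, and $\|A\|_2=\sup_{|v|\le1}|Av|$ is the spectral norm of a square matrix $A$. Prime denotes transpose. *)

(* Defs.v *)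
From HB Require Import structures.
From mathcomp Require Import all_boot all_order all_algebra.
From mathcomp Require Import all_classical all_reals all_analysis.

Set Implicit Arguments.
Unset Strict Implicit.
Unset Printing Implicit Defensive.

Import Order.TTheory GRing.Theory Num.Theory.
Import numFieldTopology.Exports numFieldNormedType.Exports.

Local Open Scope classical_set_scope.
Local Open Scope ring_scope.

Definition dotcv (R : realType) (m : nat) (u v : 'cV[R]_m) : R :=
  (u^T *m v) 0 0.

(* The canonical norm of a matrix type is the sup norm, hence this one. *)
Definition enorm (R : realType) (m : nat) (v : 'cV[R]_m) : R :=
  Num.sqrt (\sum_(i < m) v i 0 ^+ 2).

Definition spectral_norm (R : realType) (m : nat) (A : 'M[R]_m) : R :=
  sup [set enorm (A *m v) | v in [set v : 'cV[R]_m | enorm v <= 1]].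

(* Q lambda has density y |-> exp (lambda y - psi lambda) with respect to Q 0;
   psi is thereby the cumulant generating function of Q 0, finite everywhere. *)
Definition exponential_family (R : realType)
    (Q : R -> probability (measurableTypeR R) R) (psi : R -> R) : Prop :=
  forall (lambda : R) (A : set (measurableTypeR R)), measurable A ->
    Q lambda A = (\int[Q 0%R]_(y in A) (expR (lambda * y - psi lambda))%:E)%E.

(* The values on measurable rectangles determine the product measure, since
   n.-tuple carries the sigma-algebra generated by the coordinate maps. *)
Definition is_product_measure (R : realType) (n : nat)
    (P : 'I_n -> probability (measurableTypeR R) R)
    (PP : probability (n.-tuple (measurableTypeR R)) R) : Prop :=
  forall A : 'I_n -> set (measurableTypeR R), (forall i, measurable (A i)) ->
    PP [set y | forall i, A i (tnth y i)] = (\prod_(i < n) P i (A i))%E.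

Definition log_likelihood (R : realType) (n m : nat) (psi : R -> R)
    (xi : 'I_n -> 'cV[R]_m) (y : n.-tuple R) (g : 'cV[R]_m) : R :=
  \sum_(i < n) (dotcv (xi i) g * tnth y i - psi (dotcv (xi i) g)).

Definition is_mle (R : realType) (n m : nat) (psi : R -> R)
    (xi : 'I_n -> 'cV[R]_m) (y : n.-tuple R) (g : 'cV[R]_m) : Prop :=
  forall g' : 'cV[R]_m,
    log_likelihood psi xi y g' <= log_likelihood psi xi y g.

Definition information_mx (R : realType) (n m : nat) (psi : R -> R)
    (eta : 'I_n -> 'cV[R]_m) (lambda : 'I_n -> R) : 'M[R]_m :=
  n%:R^-1 *: \sum_(i < n) (derive1n 2 psi (lambda i) *: (eta i *m (eta i)^T)).

(* Main.v *)
(* Write delta = D'(g - gamma), <u, v>_A = u'Av, e_i = y_i - psi'(lambda_i) and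
   Z = sum_i e_i eta_i.  The hypothesis on B makes A coercive:
   |v|^2 <= 2 ||B^-1|| <v, v>_A.  The linearized estimator is step = A^-1 Z / n.
   Since the e_i are uncorrelated, E <step, step>_A = N_+ / n and
   E (k'step)^2 = k'A^-1 k / n <= 2 ||B^-1|| |k|^2 / n, and Markov's inequality
   controls both quantities.  Put r0^2 = 4 N_+ / (n eps).  On the ball
   <delta, delta>_A <= r0^2 the bounds on |eta_i| and on the third derivative of psi
   give, with x_i = eta_i'delta,
     psi'(lambda_i + x_i) - psi'(lambda_i) = psi''(lambda_i) x_i (1 + theta_i),
     |theta_i| <= r = sqrt(eps / N_+) / 4.
   If <step, step>_A <= r0^2 / 2, the radial derivative of the concave log-likelihood
   is negative on the sphere, so the maximizer exists, lies in the ball and is the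
   only zero of the score; the score equation then bounds the A-norm of its distance
   to step by r r0 = 1 / (2 sqrt n). *)
Require Import Defs.
From HB Require Import structures.
From mathcomp Require Import all_boot all_order all_algebra.
From mathcomp Require Import all_classical all_reals all_analysis.
From mathcomp Require Import measurable_realfun ring lra.

Set Implicit Arguments.
Unset Strict Implicit.
Unset Printing Implicit Defensive.

Import Order.TTheory GRing.Theory Num.Theory.
Import numFieldTopology.Exports numFieldNormedType.Exports.

Local Open Scope classical_set_scope.
Local Open Scope ring_scope.

(** * Exponential families *)

(** [nu] is dominated by [mu], and its Radon-Nikodym derivative has the same integrals as [g] over
    measurable sets, hence equals [g] almost everywhere; the change of variables for that derivative
    then transfers to [g]. *)
Lemma ge0_integral_density d (T : measurableType d) (R : realType)
    (nu : {finite_measure set T -> \bar R})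
    (mu : {sigma_finite_measure set T -> \bar R}) (g : T -> R)
    (mg : measurable_fun setT g) (g0 : forall x, 0 <= g x)
    (nuE : forall A, measurable A -> nu A = (\int[mu]_(x in A) (g x)%:E)%E)
    (f : T -> \bar R) :
  (forall x, (0 <= f x)%E) -> measurable_fun [set: T] f ->
  (\int[nu]_x f x = \int[mu]_x (f x * (g x)%:E))%E.
Proof.
move=> f0 mf.
have dom : nu `<< mu.
  apply/null_content_dominatesP => A mA muA0; rewrite nuE//.
  apply: null_set_integral => //; apply/measurable_funTS.
  exact/measurable_EFinP.
rewrite -(Radon_Nikodym_SigmaFinite.change_of_variables dom f0 measurableT mf).
have intg : mu.-integrable setT (Radon_Nikodym_SigmaFinite.f nu mu).
  exact: Radon_Nikodym_SigmaFinite.f_integrable.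
have mgE : measurable_fun setT (EFin \o g) by exact/measurable_EFinP.
apply: ae_eq_integral => //.
- by apply: emeasurable_funM => //; exact: measurable_int intg.
- exact: emeasurable_funM.
- apply: ae_eqe_mul2l; apply: integral_ae_eq => // E _ mE.
  by rewrite -Radon_Nikodym_SigmaFinite.f_integral// nuE.
Qed.

(** Multiplication by the nonnegative [g] commutes with taking positive and negative parts, which
    reduces to the nonnegative case. *)
Lemma integral_density d (T : measurableType d) (R : realType)
    (nu : {finite_measure set T -> \bar R})
    (mu : {sigma_finite_measure set T -> \bar R}) (g : T -> R)
    (mg : measurable_fun setT g) (g0 : forall x, 0 <= g x)
    (nuE : forall A, measurable A -> nu A = (\int[mu]_(x in A) (g x)%:E)%E)
    (f : T -> \bar R) : measurable_fun [set: T] f ->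
  (\int[nu]_x f x = \int[mu]_x (f x * (g x)%:E))%E.
Proof.
move=> mf; rewrite [LHS]integralE [RHS]integralE.
rewrite !(ge0_integral_density mg g0 nuE)//; first last.
- exact: measurable_funepos.
- exact: measurable_funeneg.
congr (_ - _)%E; apply: eq_integral => x _.
  by rewrite !funeposE muleC maxeMr ?lee_fin// mule0 muleC.
by rewrite !funenegE muleC maxeMr ?lee_fin// mule0 muleN muleC.
Qed.

Lemma integral_cst_prob d (T : measurableType d) (R : realType)
  (P : probability T R) (c : R) : (\int[P]_x c%:E = c%:E)%E.
Proof.
by rewrite integral_cst// [X in (_ * X)%E](_ : _ = 1%E) ?mule1//; exact: probability_setT.
Qed.

Section exponential_family.
Variable R : realType.
Variables (Q : R -> probability (measurableTypeR R) R) (psi : R -> R).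
Hypothesis hQ : exponential_family Q psi.

Let emoment_fun (k : nat) (s y : R) : R := y ^+ k * expR (s * y).

Let measurable_emoment_fun k s :
  measurable_fun [set: measurableTypeR R] (emoment_fun k s).
Proof.
apply: measurable_funM; first exact: measurable_funX.
by apply: measurableT_comp => //; apply: measurable_funM.
Qed.

Let measurable_expRM s :
  measurable_fun [set: measurableTypeR R] (fun y : R => expR (s * y)).
Proof. by apply: measurableT_comp => //; apply: measurable_funM. Qed.

(** This is the total mass 1 of [Q s], multiplied by [expR (psi s)]. *)
Lemma expfam_mgf (s : R) :
  (\int[Q 0%R]_y (expR (s * y))%:E = (expR (psi s))%:E)%E.
Proof.
have := hQ s (@measurableT _ (measurableTypeR R)).
rewrite probability_setT => /(congr1 (fun x => (expR (psi s))%:E * x)%E).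
rewrite mule1 => ->.
have md : measurable_fun [set: measurableTypeR R]
    (fun y : R => (expR (s * y - psi s))%:E).
  apply/measurable_EFinP; apply: measurableT_comp => //.
  by apply: measurable_funB => //; apply: measurable_funM.
rewrite -ge0_integralZl//; [|by move=> y _; rewrite lee_fin expR_ge0..].
apply: eq_integral => y _.
by rewrite -EFinM -expRD addrC subrK.
Qed.

Let integrable_expRM s : (Q 0).-integrable setT (fun y : R => (expR (s * y))%:E).
Proof.
apply/integrableP; split; first exact/measurable_EFinP.
under eq_integral do rewrite gee0_abs ?lee_fin ?expR_ge0//.
by rewrite expfam_mgf ltry.
Qed.

(** An integrable majorant, uniform over [|s| <= c]: [|y|^k] is at most [exp (k |y|)], and
    [exp (a |y|)] is at most [exp (a y) + exp (- a y)]. *)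
Let emoment_bound (k : nat) (c : R) (y : R) : R :=
  expR ((k%:R + c) * y) + expR (- (k%:R + c) * y).

Let emoment_boundE k (s c y : R) : `|s| <= c ->
  `|emoment_fun k s y| <= emoment_bound k c y.
Proof.
move=> sc; rewrite normrM normrX (ger0_norm (expR_ge0 _)).
have h1 : `|y| ^+ k <= expR (k%:R * `|y|).
  rewrite expRM_natl lerXn2r ?nnegrE ?expR_ge0//.
  by rewrite (le_trans _ (expR_ge1Dx _))// lerDr.
have h2 : expR (s * y) <= expR (c * `|y|).
  rewrite ler_expR (le_trans (ler_norm _))// normrM ler_wpM2r//.
apply: (@le_trans _ _ (expR ((k%:R + c) * `|y|))).
  by rewrite mulrDl expRD ler_pM// ?exprn_ge0// expR_ge0.
rewrite /emoment_bound; have [y0|y0] := leP 0 y.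
  by rewrite ger0_norm// lerDl expR_ge0.
by rewrite ltr0_norm// mulrN -mulNr lerDr expR_ge0.
Qed.

Let integrable_emoment_bound k c :
  (Q 0).-integrable setT (EFin \o emoment_bound k c).
Proof.
have -> : EFin \o emoment_bound k c = (fun y : R => (expR ((k%:R + c) * y))%:E) \+
   (fun y : R => (expR (- (k%:R + c) * y))%:E) by apply/funext.
exact: integrableD.
Qed.

Let integrable_emoment k s : (Q 0).-integrable setT (EFin \o emoment_fun k s).
Proof.
apply: (le_integrable measurableT _ _ (integrable_emoment_bound k `|s|)).
  exact/measurable_EFinP.
move=> y _ /=; rewrite lee_fin (le_trans (emoment_boundE _ _ (lexx _)))//.
exact: ler_norm.
Qed.

(** The [k]-th derivative at [s] of the moment generating function of [Q 0]; divided by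
    [emoment 0 s] it is the [k]-th moment of [Q s]. *)
Definition emoment (k : nat) (s : R) : R := \int[Q 0%R]_y emoment_fun k s y.

(** Differentiation under the integral sign on the interval []s - 1, s + 1[], where the derivatives
    are dominated by [emoment_bound k.+1 (|s| + 1)]. *)
Lemma is_derive_emoment k (s : R) : is_derive s 1 (emoment k) (emoment k.+1 s).
Proof.
have sI : `]s - 1, s + 1[%classic s by rewrite /= in_itv/=; apply/andP; split; lra.
have dE (x y : R) : is_derive x 1 (emoment_fun k ^~ y) (emoment_fun k.+1 x y).
  have -> : emoment_fun k ^~ y = y ^+ k *: (expR \o (y *: id)).
    by apply/funext => t /=; rewrite /emoment_fun mulrC [t * y]mulrC [RHS]mulrC.
  apply: is_derive_eq.
  by rewrite /emoment_fun/= /GRing.scale/= exprS (mulrC x y); ring.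
have d1 (x y : R) : partial1of2 (emoment_fun k) x y = emoment_fun k.+1 x y.
  by rewrite partial1of2E; apply: derive_val.
have intf x : `]s - 1, s + 1[%classic x ->
    (Q 0).-integrable setT (EFin \o emoment_fun k x).
  by move=> _; exact: integrable_emoment.
have G0 y : 0 <= emoment_bound k.+1 (`|s| + 1) y by rewrite addr_ge0 ?expR_ge0.
have Gub (x y : R) : `]s - 1, s + 1[%classic x -> setT y ->
   `|partial1of2 (emoment_fun k) x y| <= emoment_bound k.+1 (`|s| + 1) y.
  move=> /=; rewrite in_itv/= => /andP[x1 x2] _; rewrite d1; apply: emoment_boundE.
  by rewrite -[x](subrK s) addrC (le_trans (ler_normD _ _))// lerD2l ler_norml; lra.
have df (x y : R) : `]s - 1, s + 1[%classic x -> setT y ->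
    derivable (emoment_fun k ^~ y) x 1.
  by move=> _ _; exact: ex_derive.
apply: DeriveDef.
  exact: (derivable_under_integral measurableT sI intf df G0
    (integrable_emoment_bound k.+1 (`|s| + 1)) Gub).
rewrite -derive1E.
rewrite (differentiation_under_integral measurableT sI intf df G0
    (integrable_emoment_bound k.+1 (`|s| + 1)) Gub).
by apply: eq_Rintegral => y _; rewrite d1.
Qed.

Lemma emoment0E s : emoment 0 s = expR (psi s).
Proof.
rewrite /emoment /emoment_fun /Rintegral.
by under eq_integral do rewrite expr0 mul1r; rewrite expfam_mgf.
Qed.

Let emoment0_neq0 s : emoment 0 s != 0.
Proof. by rewrite emoment0E gt_eqF// expR_gt0. Qed.

Lemma is_derive_cumulant (s : R) : is_derive s 1 psi (emoment 1 s / emoment 0 s).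
Proof.
have -> : psi = @ln R \o emoment 0 by apply/funext => t /=; rewrite emoment0E expRK.
have := is_derive_emoment 0 s.
have := @is_derive1_ln R (emoment 0 s); rewrite emoment0E => /(_ (expR_gt0 _)).
rewrite -emoment0E => h1 h2.
by apply: is_derive_eq; rewrite mulrC.
Qed.

Lemma derive1_cumulant : derive1 psi = (fun s => emoment 1 s / emoment 0 s).
Proof.
apply/funext => s; rewrite derive1E; apply: derive_val.
exact: is_derive_cumulant.
Qed.

Let is_derive_ratio k (s : R) :
  is_derive s 1 (fun t => emoment k t / emoment 0 t)
    (emoment k.+1 s / emoment 0 s - emoment k s * emoment 1 s / emoment 0 s ^+ 2).
Proof.
have h1 := is_derive_emoment k s.
have h2 := is_deriveV (emoment0_neq0 s) (is_derive_emoment 0 s).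
have := is_deriveM h1 h2.
move=> h; apply: (is_derive_eq h).
rewrite /GRing.scale/=; field.
exact: emoment0_neq0.
Qed.

Lemma derive1n2_cumulant :
  derive1n 2 psi =
  (fun s => emoment 2 s / emoment 0 s - (emoment 1 s / emoment 0 s) ^+ 2).
Proof.
apply/funext => s; rewrite derive1nS derive1n1 derive1_cumulant derive1E.
have h := is_derive_ratio 1 s; rewrite derive_val.
by field; exact: emoment0_neq0.
Qed.

Lemma derivable_cumulant2 (s : R) : derivable (derive1 psi) s 1.
Proof. by rewrite derive1_cumulant; have h := is_derive_ratio 1 s; exact: ex_derive. Qed.

Lemma derivable_cumulant3 (s : R) : derivable (derive1n 2 psi) s 1.
Proof.
have h1 := is_derive_ratio 1 s; have h2 := is_derive_ratio 2 s.
have -> : derive1n 2 psi = (fun t => emoment 2 t / emoment 0 t) -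
   (fun t => emoment 1 t / emoment 0 t) ^+ 2.
  by rewrite derive1n2_cumulant.
by apply: derivableB; [|apply: derivableX]; exact: ex_derive.
Qed.

Let expfam_integral s (f : R -> R) : measurable_fun [set: measurableTypeR R] f ->
  (\int[Q s]_y (f y)%:E = \int[Q 0%R]_y (f y * expR (s * y - psi s))%:E)%E.
Proof.
move=> mf; rewrite (@integral_density _ _ _ (Q s) (Q 0)
  (fun y : R => expR (s * y - psi s))).
- by [].
- by apply: measurableT_comp => //; apply: measurable_funB => //; apply: measurable_funM.
- by move=> y; exact: expR_ge0.
- by move=> A mA; exact: hQ.
- exact/measurable_EFinP.
Qed.

Let exprn_density k (s y : R) :
  y ^+ k * expR (s * y - psi s) = expR (- psi s) * emoment_fun k s y.
Proof. by rewrite expRD /emoment_fun; ring. Qed.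

Lemma expfam_integrable_exprn k s : (Q s).-integrable setT (fun y => (y ^+ k)%:E).
Proof.
apply/integrableP; split; first exact/measurable_EFinP/measurable_funX.
rewrite (@expfam_integral s (fun y => `|y ^+ k|)).
  under eq_integral do rewrite -(ger0_norm (expR_ge0 (s * _ - _))) -normrM
    exprn_density normrM ger0_norm ?expR_ge0// EFinM.
  have /integrableP[_ h] := integrable_emoment k s.
  rewrite ge0_integralZl//.
  - by rewrite lte_mul_pinfty// lee_fin expR_ge0.
  - by apply/measurable_EFinP; apply: measurableT_comp.
by apply: measurableT_comp => //; exact: measurable_funX.
Qed.

Lemma expfam_integral_exprn k s :
  (\int[Q s]_y (y ^+ k)%:E = (emoment k s / emoment 0 s)%:E)%E.
Proof.
rewrite (@expfam_integral s (fun y => y ^+ k)); last exact: measurable_funX.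
under eq_integral do rewrite exprn_density EFinM.
rewrite integralZl//; last exact: integrable_emoment.
rewrite emoment0E mulrC -expRN EFinM /emoment /Rintegral fineK//.
apply: integrable_fin_num => //; exact: integrable_emoment.
Qed.

Lemma expfam_integrable_centered s :
  (Q s).-integrable setT (fun y => (y - derive1 psi s)%:E).
Proof.
under eq_fun do rewrite -[X in X - _]expr1 EFinB.
apply: integrableB => //; first exact: expfam_integrable_exprn.
 exact: finite_measure_integrable_cst.
Qed.

Lemma expfam_mean s : (\int[Q s]_y (y - derive1 psi s)%:E = 0)%E.
Proof.
under eq_integral do rewrite -[X in X - _]expr1 EFinB.
rewrite integralB_EFin//; first last.
- exact: finite_measure_integrable_cst.
- exact: expfam_integrable_exprn.
rewrite expfam_integral_exprn integral_cst_prob.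
by rewrite derive1_cumulant subee.
Qed.

(** The exponent 1 is kept so that every nonconstant term is a power covered by
    [expfam_integral_exprn]. *)
Let centered_sqr m (y : R) : (y - m) ^+ 2 = (y ^+ 2 - 2 * m * y ^+ 1) + m ^+ 2.
Proof. by ring. Qed.

Let integrable_lin m s :
  (Q s).-integrable setT (fun y => (y ^+ 2 - 2 * m * y ^+ 1)%:E).
Proof.
under eq_fun do rewrite EFinB (EFinM (2 * _)).
apply: integrableB => //; first exact: expfam_integrable_exprn.
by apply: integrableZl => //; exact: expfam_integrable_exprn.
Qed.

Lemma expfam_integrable_centered_sqr s :
  (Q s).-integrable setT (fun y => ((y - derive1 psi s) ^+ 2)%:E).
Proof.
under eq_fun do rewrite centered_sqr EFinD.
apply: integrableD => //; first exact: integrable_lin.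
exact: finite_measure_integrable_cst.
Qed.

Lemma expfam_variance s :
  (\int[Q s]_y ((y - derive1 psi s) ^+ 2)%:E = (derive1n 2 psi s)%:E)%E.
Proof.
set m := derive1 psi s.
have lin : (\int[Q s]_y (y ^+ 2 - 2 * m * y ^+ 1)%:E =
    (emoment 2 s / emoment 0 s - 2 * m * (emoment 1 s / emoment 0 s))%:E)%E.
  under eq_integral do rewrite EFinB (EFinM (2 * _)).
  rewrite integralB//.
  - by rewrite integralZl// ?expfam_integral_exprn//; exact: expfam_integrable_exprn.
  - exact: expfam_integrable_exprn.
  - by apply: integrableZl => //; exact: expfam_integrable_exprn.
transitivity (\int[Q s]_y ((y ^+ 2 - 2 * m * y ^+ 1)%:E + (m ^+ 2)%:E))%E.
  by apply: eq_integral => y _; rewrite centered_sqr EFinD.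
rewrite integralD//.
- rewrite lin integral_cst_prob derive1n2_cumulant /m derive1_cumulant -EFinD.
  by congr EFin; ring.
- exact: integrable_lin.
- exact: finite_measure_integrable_cst.
Qed.

End exponential_family.

(** * Independent coordinates and quadratic forms *)

Lemma integral_law d d' (T : measurableType d) (T' : measurableType d')
    (R : realType) (P : {measure set T -> \bar R}) (mu : {measure set T' -> \bar R})
    (phi : T -> T') (mphi : measurable_fun setT phi)
    (law : forall A, measurable A -> P (phi @^-1` A) = mu A)
    (f : T' -> \bar R) : measurable_fun [set: T'] f ->
  (\int[P]_x f (phi x) = \int[mu]_y f y)%E.
Proof.
move=> mf.
have ge0 (g : T' -> \bar R) : (forall y, (0 <= g y)%E) -> measurable_fun [set: T'] g ->
    (\int[P]_x g (phi x) = \int[mu]_y g y)%E.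
  move=> g0 mg.
  rewrite -[LHS](@ge0_integral_pushforward _ _ _ _ _ _ mphi P setT g)//.
  by apply: eq_measure_integral => A mA _; rewrite -law.
rewrite [LHS]integralE [RHS]integralE; congr (_ - _)%E.
- by rewrite -ge0//; [apply: eq_integral => x _; rewrite !funeposE|exact: measurable_funepos].
- by rewrite -ge0//; [apply: eq_integral => x _; rewrite !funenegE|exact: measurable_funeneg].
Qed.

Lemma integrable_law d d' (T : measurableType d) (T' : measurableType d')
    (R : realType) (P : {measure set T -> \bar R}) (mu : {measure set T' -> \bar R})
    (phi : T -> T') (mphi : measurable_fun setT phi)
    (law : forall A, measurable A -> P (phi @^-1` A) = mu A)
    (f : T' -> \bar R) : mu.-integrable setT f -> P.-integrable setT (f \o phi).
Proof.
move=> /integrableP[mf fi]; apply/integrableP; split; first exact: measurableT_comp.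
rewrite (integral_law mphi law (f := fun y => `|f y|%E))//.
exact: measurableT_comp.
Qed.

Section product_measure.
Variables (R : realType) (n : nat).
Variable P : 'I_n -> probability (measurableTypeR R) R.
Variable PP : probability (n.-tuple (measurableTypeR R)) R.
Hypothesis hPP : is_product_measure P PP.

Let mtnth (i : 'I_n) :
  measurable_fun [set: n.-tuple (measurableTypeR R)] (fun y => tnth y i).
Proof. exact: measurable_tnth. Qed.

(** The event is a rectangle whose other sides are the whole line, each of probability 1. *)
Lemma product_measure_marginal (i : 'I_n) (A : set (measurableTypeR R)) :
  measurable A -> PP [set y | A (tnth y i)] = P i A.
Proof.
move=> mA; have := @hPP (fun j => if j == i then A else setT).
rewrite (bigD1 i)//= eqxx big1 ?mule1; last first.
  by move=> j /negbTE ->; exact: probability_setT.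
move=> <-; last by move=> j; case: ifP.
congr (PP _); apply/seteqP; split=> y /=.
  by move=> Ay j; case: ifPn => // /eqP ->.
by move=> /(_ i); rewrite eqxx.
Qed.

(** Product measures are determined by rectangles, and on these the joint law of two coordinates is
    read off from a rectangle with all other sides full. *)
Lemma product_measure_pair (i j : 'I_n) (X : set (measurableTypeR R * measurableTypeR R)) :
  i != j -> measurable X ->
  PP [set y | X (tnth y i, tnth y j)] = (P i \x P j)%E X.
Proof.
move=> ij mX.
have mpair : measurable_fun [set: n.-tuple (measurableTypeR R)]
    (fun y => (tnth y i, tnth y j)) by exact: measurable_fun_pair.
rewrite (@product_measure_unique _ _ _ _ _ (P i) (P j)
  (pushforward PP (fun y => (tnth y i, tnth y j))))//.
move=> A B mA mB; rewrite /pushforward.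
have := @hPP (fun k => if k == i then A else if k == j then B else setT).
rewrite (bigD1 i)//= eqxx (bigD1 j)//=; last by rewrite eq_sym.
rewrite eqxx [j == i]eq_sym (negbTE ij) big1 ?mule1; last first.
  by move=> k /andP[/negbTE -> /negbTE ->]; exact: probability_setT.
move=> <-; last by move=> k; case: ifP => // _; case: ifP.
congr (PP _); apply/seteqP; split=> y /=.
  by move=> [Ay By] k; case: ifPn => [/eqP ->//|_]; case: ifPn => // /eqP ->.
move=> h; split; first by move: (h i); rewrite eqxx.
by move: (h j); rewrite eqxx eq_sym (negbTE ij).
Qed.

Section independent_coordinates.
Variables (i j : 'I_n) (f g : R -> R).
Hypothesis ij : i != j.
Hypothesis fi : (P i).-integrable setT (EFin \o f).
Hypothesis gi : (P j).-integrable setT (EFin \o g).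

Let mf : measurable_fun [set: measurableTypeR R] f.
Proof. by apply/measurable_EFinP; exact: measurable_int fi. Qed.

Let mg : measurable_fun [set: measurableTypeR R] g.
Proof. by apply/measurable_EFinP; exact: measurable_int gi. Qed.

Let fg (z : measurableTypeR R * measurableTypeR R) : \bar R := (f z.1 * g z.2)%:E.

Let mfg : measurable_fun setT fg.
Proof.
by apply/measurable_EFinP; apply: measurable_funM; apply: measurableT_comp.
Qed.

Let fgi : (P i \x P j)%E.-integrable setT fg.
Proof.
apply/(integrable12ltyP _ _ mfg).
(* Tonelli: the inner integral of the absolute value is a finite constant times [|f x|]. *)
have -> : (fun x : R => \int[P j]_y `|fg (x, y)|)%E =
    (fun x => (fine (\int[P j]_y `|(g y)%:E|))%:E * `|(f x)%:E|)%E.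
  apply/funext => x; rewrite fineK.
    rewrite muleC -ge0_integralZl//.
    - by apply: eq_integral => y _; rewrite /fg /= normrM EFinM.
    - by apply/measurable_EFinP; apply: measurableT_comp.
  by have := integrable_fin_num measurableT (integrable_abse gi).
have /integrableP[_ fo] := fi; have /integrableP[_ go] := gi.
rewrite ge0_integralZl//.
- by apply: lte_mul_pinfty => //; rewrite lee_fin fine_ge0// integral_ge0.
- by apply/measurable_EFinP; apply: measurableT_comp.
- by rewrite lee_fin fine_ge0// integral_ge0.
Qed.

Let mpair : measurable_fun [set: n.-tuple (measurableTypeR R)]
  (fun y => (tnth y i, tnth y j)).
Proof. exact: measurable_fun_pair. Qed.

Lemma product_measure_integrableM :
  PP.-integrable setT (fun y => (f (tnth y i) * g (tnth y j))%:E).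
Proof.
apply: (integrable_law mpair _ fgi) => X mX; exact: product_measure_pair.
Qed.

Lemma product_measure_integralM :
  (\int[PP]_y (f (tnth y i) * g (tnth y j))%:E =
   \int[P i]_x (f x)%:E * \int[P j]_x (g x)%:E)%E.
Proof.
rewrite (@integral_law _ _ _ _ _ PP (P i \x P j)%E _ mpair _ fg)//; last first.
  by move=> X mX; exact: product_measure_pair.
rewrite -(integral12_prod_meas1 fgi).
have gfin : (\int[P j]_x (g x)%:E)%E \is a fin_num.
  exact: integrable_fin_num.
transitivity (\int[P i]_x (fine (\int[P j]_y (g y)%:E) * f x)%:E)%E.
  apply: eq_integral => x _; rewrite mulrC EFinM fineK// -integralZl//.
by under eq_integral do rewrite EFinM; rewrite integralZl// fineK// muleC.
Qed.

End independent_coordinates.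

Lemma product_measure_integrable1 i (f : R -> R) :
  (P i).-integrable setT (EFin \o f) ->
  PP.-integrable setT (fun y => (f (tnth y i))%:E).
Proof.
apply: (integrable_law (mtnth i)) => A mA; exact: product_measure_marginal.
Qed.

Lemma product_measure_integral1 i (f : R -> R) :
  measurable_fun [set: measurableTypeR R] f ->
  (\int[PP]_y (f (tnth y i))%:E = \int[P i]_x (f x)%:E)%E.
Proof.
move=> mf; apply: (integral_law (mtnth i)); last exact/measurable_EFinP.
by move=> A mA; exact: product_measure_marginal.
Qed.

End product_measure.

Section centered_quadratic_form.
Variables (R : realType) (n : nat).
Variable P : 'I_n -> probability (measurableTypeR R) R.
Variable PP : probability (n.-tuple (measurableTypeR R)) R.
Hypothesis hPP : is_product_measure P PP.
Variables (mu v : 'I_n -> R).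
Hypothesis mi : forall i, (P i).-integrable setT (fun y => (y - mu i)%:E).
Hypothesis meanP : forall i, (\int[P i]_y (y - mu i)%:E = 0)%E.
Hypothesis vi : forall i, (P i).-integrable setT (fun y => ((y - mu i) ^+ 2)%:E).
Hypothesis varP : forall i, (\int[P i]_y ((y - mu i) ^+ 2)%:E = (v i)%:E)%E.
Variable c : 'I_n -> 'I_n -> R.

Let term_integrable i l :
  PP.-integrable setT (fun y => ((tnth y i - mu i) * (tnth y l - mu l))%:E).
Proof.
have [<-|il] := eqVneq i l.
  under eq_fun do rewrite -expr2.
  exact: (product_measure_integrable1 hPP (f := fun y => (y - mu i) ^+ 2)).
exact: (product_measure_integrableM hPP (f := fun y => y - mu i)
  (g := fun y => y - mu l)).
Qed.

Let term_integral i l :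
  (\int[PP]_y ((tnth y i - mu i) * (tnth y l - mu l))%:E =
   (if l == i then v i else 0)%:E)%E.
Proof.
have [->|il] := eqVneq l i.
  under eq_integral do rewrite -expr2.
  rewrite (product_measure_integral1 hPP i (f := fun y => (y - mu i) ^+ 2)) ?varP//.
  by apply/measurable_EFinP; exact: measurable_int (vi i).
rewrite (product_measure_integralM hPP (f := fun y => y - mu i)
  (g := fun y => y - mu l))//; last by rewrite eq_sym.
by rewrite meanP mul0e.
Qed.

(** Both random quantities fed to Markov's inequality have this shape, for suitable coefficients
    [c]. *)
Definition centered_form (y : n.-tuple R) : R :=
  \sum_(i < n) \sum_(l < n) c i l * ((tnth y i - mu i) * (tnth y l - mu l)).

Let row_integrable i : PP.-integrable setT
  (fun y => (\sum_(l < n) c i l * ((tnth y i - mu i) * (tnth y l - mu l)))%:E).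
Proof.
under eq_fun do rewrite -sumEFin; apply: integrable_sum => // l _.
by under eq_fun do rewrite EFinM; apply: integrableZl.
Qed.

Lemma integrable_centered_form : PP.-integrable setT (EFin \o centered_form).
Proof.
rewrite /comp /centered_form.
by under eq_fun do rewrite -sumEFin; apply: integrable_sum => // l _.
Qed.

(** Off-diagonal products have mean zero by independence and centering, so only the variances
    survive. *)
Lemma integral_centered_form :
  (\int[PP]_y (centered_form y)%:E = (\sum_(i < n) c i i * v i)%:E)%E.
Proof.
under eq_integral do rewrite /centered_form -sumEFin.
rewrite integral_sum// -sumEFin; apply: eq_bigr => i _.
under eq_integral do rewrite -sumEFin.
rewrite integral_sum//; last first.
  by move=> l; under eq_fun do rewrite EFinM; apply: integrableZl.
rewrite (bigD1 i)//= big1 ?adde0.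
  by under eq_integral do rewrite EFinM; rewrite integralZl// term_integral eqxx.
move=> l /negbTE li; under eq_integral do rewrite EFinM.
by rewrite integralZl// term_integral li mule0.
Qed.

End centered_quadratic_form.

(** * Markov's inequality *)

Lemma measurable_superlevel d (T : measurableType d) (R : realType)
    (X : T -> R) (a : R) : measurable_fun setT X -> measurable [set x | a < X x].
Proof.
move=> mX; rewrite [X in measurable X](_ : _ = setT `&` X @^-1` `]a, +oo[).
  exact: mX.
by rewrite setTI; apply/seteqP; split=> x /=; rewrite in_itv/= andbT.
Qed.

Lemma markov_ge0 d (T : measurableType d) (R : realType) (P : probability T R)
    (X : T -> R) (m a : R) : measurable_fun setT X -> (forall x, 0 <= X x) ->
  (\int[P]_x (X x)%:E <= m%:E)%E -> 0 < a ->
  (P [set x | (a < X x)%R] <= (m / a)%:E)%E.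
Proof.
move=> mX X0 Xm a0; rewrite EFinM lee_pdivlMr// muleC.
have mS := measurable_superlevel a mX.
apply: le_trans Xm.
have -> : (a%:E * P [set x | (a < X x)%R] = \int[P]_(x in [set x | (a < X x)%R]) a%:E)%E.
  by rewrite integral_cst.
apply: (@le_trans _ _ (\int[P]_(x in [set x | (a < X x)%R]) (X x)%:E)%E).
  apply: ge0_le_integral => //=.
  - by move=> x _; rewrite lee_fin ltW.
  - by apply/measurable_EFinP; exact: measurable_funTS.
  - by move=> x /= /ltW; rewrite lee_fin.
apply: ge0_subset_integral => //; first exact/measurable_EFinP.
by move=> x _; rewrite lee_fin.
Qed.

(** * Euclidean and spectral norms *)

Section euclidean.
Variables (R : realType) (m : nat).
Implicit Types (u v w : 'cV[R]_m) (A B : 'M[R]_m).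

Lemma dotcvE u v : dotcv u v = \sum_(i < m) u i 0 * v i 0.
Proof. by rewrite /dotcv mxE; apply: eq_bigr => i _; rewrite mxE. Qed.

Lemma dotcvC u v : dotcv u v = dotcv v u.
Proof. by rewrite !dotcvE; apply: eq_bigr => i _; rewrite mulrC. Qed.

Lemma dotcvDr u v w : dotcv u (v + w) = dotcv u v + dotcv u w.
Proof. by rewrite /dotcv mulmxDr mxE. Qed.

Lemma dotcvZr u v (a : R) : dotcv u (a *: v) = a * dotcv u v.
Proof. by rewrite /dotcv -scalemxAr mxE. Qed.

Lemma dotcvBr u v w : dotcv u (v - w) = dotcv u v - dotcv u w.
Proof. by rewrite dotcvDr -scaleN1r dotcvZr mulN1r. Qed.

Lemma dotcv0r u : dotcv u 0 = 0.
Proof. by rewrite /dotcv mulmx0 mxE. Qed.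

Lemma dotcvDl u v w : dotcv (u + v) w = dotcv u w + dotcv v w.
Proof. by rewrite dotcvC dotcvDr !(dotcvC w). Qed.

Lemma dotcvZl u v (a : R) : dotcv (a *: u) v = a * dotcv u v.
Proof. by rewrite dotcvC dotcvZr dotcvC. Qed.

Lemma dotcvBl u v w : dotcv (u - v) w = dotcv u w - dotcv v w.
Proof. by rewrite dotcvC dotcvBr !(dotcvC w). Qed.

Lemma dotcv_sumr (I : Type) (r : seq I) u (F : I -> 'cV[R]_m) :
  dotcv u (\sum_(i <- r) F i) = \sum_(i <- r) dotcv u (F i).
Proof. by rewrite /dotcv mulmx_sumr summxE. Qed.

Lemma dotcv_mulmxr u v A : dotcv u (A *m v) = dotcv (A^T *m u) v.
Proof. by rewrite /dotcv trmx_mul trmxK mulmxA. Qed.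

Lemma dotcv_ge0 v : 0 <= dotcv v v.
Proof. by rewrite dotcvE sumr_ge0// => i _; rewrite -expr2 sqr_ge0. Qed.

Lemma dotcv_eq0 v : dotcv v v = 0 -> v = 0.
Proof.
rewrite dotcvE => /eqP; rewrite psumr_eq0 => [|i _]; last by rewrite -expr2 sqr_ge0.
move=> /allP h; apply/colP => i; rewrite mxE.
by have := h i (mem_index_enum _); rewrite mulf_eq0 orbb => /eqP.
Qed.

Lemma enorm_sqr v : enorm v ^+ 2 = dotcv v v.
Proof.
rewrite /enorm sqr_sqrtr.
  by rewrite dotcvE; apply: eq_bigr => i _; rewrite expr2.
by rewrite sumr_ge0// => i _; rewrite sqr_ge0.
Qed.

Lemma enorm_ge0 v : 0 <= enorm v.
Proof. exact: sqrtr_ge0. Qed.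

Lemma enorm_dotcv v : enorm v = Num.sqrt (dotcv v v).
Proof. by rewrite -enorm_sqr sqrtr_sqr ger0_norm ?enorm_ge0. Qed.

Lemma enormZ (a : R) v : enorm (a *: v) = `|a| * enorm v.
Proof.
by rewrite !enorm_dotcv dotcvZl dotcvZr mulrA -expr2 sqrtrM ?sqr_ge0// sqrtr_sqr.
Qed.

Lemma enorm0_eq0 v : enorm v = 0 -> v = 0.
Proof. by move=> v0; apply: dotcv_eq0; rewrite -enorm_sqr v0 expr0n. Qed.

(** The form is nonnegative at [u - t v] for every [t]; a suitable [t] yields the inequality. As [A]
    is only semidefinite, the case of a nonzero [v] of form value zero is treated apart. *)
Lemma cauchy_schwarz_psd A u v : A^T = A -> (forall w, 0 <= dotcv w (A *m w)) ->
  dotcv u (A *m v) ^+ 2 <= dotcv u (A *m u) * dotcv v (A *m v).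
Proof.
move=> symA psdA.
have expand t : dotcv (u - t *: v) (A *m (u - t *: v)) =
    dotcv u (A *m u) - 2 * t * dotcv u (A *m v) + t ^+ 2 * dotcv v (A *m v).
  rewrite mulmxBr -scalemxAr !dotcvBl !dotcvBr !dotcvZl !dotcvZr.
  have -> : dotcv v (A *m u) = dotcv u (A *m v) by rewrite dotcv_mulmxr symA dotcvC.
  by ring.
have qv := psdA v; have qu := psdA u.
have [qv0|qv0] := eqVneq (dotcv v (A *m v)) 0; last first.
  have qvp : 0 < dotcv v (A *m v) by rewrite lt_def qv0.
  (* This [t] minimizes the quadratic polynomial in [t]. *)
  have := psdA (u - (dotcv u (A *m v) / dotcv v (A *m v)) *: v).
  rewrite expand => h.
  have : 0 <= dotcv v (A *m v) * (dotcv u (A *m u) -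
     2 * (dotcv u (A *m v) / dotcv v (A *m v)) * dotcv u (A *m v) +
    (dotcv u (A *m v) / dotcv v (A *m v)) ^+ 2 * dotcv v (A *m v)) by rewrite mulr_ge0.
  rewrite (_ : dotcv v (A *m v) * _ =
    dotcv u (A *m u) * dotcv v (A *m v) - dotcv u (A *m v) ^+ 2).
    by rewrite subr_ge0.
  by field.
rewrite qv0 mulr0.
have [->|b0] := eqVneq (dotcv u (A *m v)) 0; first by rewrite expr0n.
(* The polynomial is now affine in [t] with nonzero slope; this [t] makes its value -1, a
   contradiction. *)
have := psdA (u - ((dotcv u (A *m u) + 1) / (2 * dotcv u (A *m v))) *: v).
rewrite expand qv0 mulr0 addr0.
rewrite (_ : 2 * _ * _ = dotcv u (A *m u) + 1); last by field.
by rewrite opprD addrA subrr sub0r oppr_ge0 ler10.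
Qed.

Lemma cauchy_schwarz u v : dotcv u v ^+ 2 <= dotcv u u * dotcv v v.
Proof.
have := @cauchy_schwarz_psd 1%:M u v; rewrite !mul1mx; apply; first exact: trmx1.
by move=> w; rewrite mul1mx dotcv_ge0.
Qed.

Lemma dotcv_le_enorm u v : dotcv u v <= enorm u * enorm v.
Proof.
rewrite (le_trans (ler_norm _))// -ler_sqr ?nnegrE ?normr_ge0 ?mulr_ge0 ?enorm_ge0//.
by rewrite real_normK ?num_real// exprMn !enorm_sqr cauchy_schwarz.
Qed.

Lemma enormD u v : enorm (u + v) <= enorm u + enorm v.
Proof.
rewrite -ler_sqr ?nnegrE ?addr_ge0 ?enorm_ge0// sqrrD !enorm_sqr.
rewrite dotcvDl !dotcvDr (dotcvC v u).
by have := dotcv_le_enorm u v; lra.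
Qed.

(** The squared Frobenius norm, used to bound the set whose supremum is the spectral norm. *)
Let frobenius A := \sum_(i < m) dotcv (row i A)^T (row i A)^T.

Let enorm_mulmx_frobenius A v : enorm (A *m v) <= Num.sqrt (frobenius A) * enorm v.
Proof.
rewrite !enorm_dotcv -sqrtrM; last by rewrite sumr_ge0// => i _; rewrite dotcv_ge0.
rewrite ler_wsqrtr// [leLHS]dotcvE mulr_suml ler_sum// => i _.
rewrite -expr2 (_ : (A *m v) i 0 = dotcv (row i A)^T v) ?cauchy_schwarz//.
by rewrite dotcvE mxE; apply: eq_bigr => j _; rewrite !mxE.
Qed.

(** Needed because [sup] is an actual least upper bound only for a nonempty bounded set. *)
Lemma spectral_norm_has_sup A :
  has_sup [set enorm (A *m v) | v in [set v : 'cV[R]_m | enorm v <= 1]].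
Proof.
have e0 : enorm (0 : 'cV[R]_m) = 0 by rewrite enorm_dotcv dotcv0r sqrtr0.
split; first by exists (enorm (A *m 0)); exists 0; rewrite //= e0.
exists (Num.sqrt (frobenius A)) => _ [v /= v1 <-].
rewrite (le_trans (enorm_mulmx_frobenius _ _))// ler_piMr//.
Qed.

Lemma spectral_norm_ge0 A : 0 <= spectral_norm A.
Proof.
have e0 : enorm (0 : 'cV[R]_m) = 0 by rewrite enorm_dotcv dotcv0r sqrtr0.
have [_ ub] := spectral_norm_has_sup A.
rewrite (le_trans (enorm_ge0 (A *m 0)))//; apply: ub_le_sup => //.
by exists 0; rewrite //= e0.
Qed.

Lemma enorm_mulmx A v : enorm (A *m v) <= spectral_norm A * enorm v.
Proof.
have [/enorm0_eq0 ->|v0] := eqVneq (enorm v) 0.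
  by rewrite mulmx0 !enorm_dotcv dotcv0r sqrtr0 mulr0.
have vp : 0 < enorm v by rewrite lt_def v0 enorm_ge0.
rewrite -ler_pdivrMr// mulrC -[X in X * _](ger0_norm (_ : 0 <= (enorm v)^-1)); last first.
  by rewrite invr_ge0 ltW.
rewrite -enormZ scalemxAr.
have [_ ub] := spectral_norm_has_sup A.
apply: ub_le_sup => //; exists ((enorm v)^-1 *: v) => //=.
by rewrite enormZ ger0_norm ?invr_ge0 ?enorm_ge0// mulVf.
Qed.

(** Coercivity makes the kernel trivial; symmetry passes from the row kernel to the column
    kernel. *)
Lemma sym_coercive_unitmx A (b : R) : A^T = A ->
  (forall v, enorm v <= b * enorm (A *m v)) -> A \in unitmx.
Proof.
move=> symA coer; rewrite -row_free_unit; apply/inj_row_free => v vA0.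
apply: trmx_inj; rewrite trmx0; apply: enorm0_eq0; apply/eqP.
rewrite eq_le enorm_ge0 andbT (le_trans (coer _))//.
by rewrite -symA -trmx_mul vA0 trmx0 enorm_dotcv dotcv0r sqrtr0 mulr0.
Qed.

(* With w = A^-1 v, Cauchy-Schwarz for the form A gives (v'v)^2 = (v'Aw)^2 <= (v'Av)(w'v). *)
Lemma psd_coercive A (b : R) : A^T = A -> (forall w, 0 <= dotcv w (A *m w)) ->
  0 <= b -> (forall v, enorm v <= b * enorm (A *m v)) ->
  forall v, dotcv v v <= b * dotcv v (A *m v).
Proof.
move=> symA psdA b0 coer v.
have uA := sym_coercive_unitmx symA coer.
have [v0|v0] := eqVneq (dotcv v v) 0; first by rewrite v0 mulr_ge0.
have vp : 0 < dotcv v v by rewrite lt_def v0 dotcv_ge0.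
set w := invmx A *m v.
have Aw : A *m w = v by rewrite mulKVmx.
have h1 := cauchy_schwarz_psd v w symA psdA.
rewrite Aw in h1.
have h2 : dotcv w v <= b * dotcv v v.
  rewrite (le_trans (dotcv_le_enorm _ _))// -enorm_sqr expr2 mulrA ler_wpM2r ?enorm_ge0//.
  by rewrite -[X in _ * enorm X]Aw.
rewrite -(ler_pM2r vp) -expr2 (le_trans h1)// [leRHS]mulrAC mulrC.
by rewrite [leRHS](_ : _ = (b * dotcv v v) * dotcv v (A *m v)) ?ler_wpM2r//; ring.
Qed.

(** With [b] the norm of the inverse of [B], [|v| <= b |B v| <= b |A v| + |v| / 2], and the last
    term is absorbed. *)
Lemma perturbed_coercive A B v : B \in unitmx ->
  spectral_norm (A - B) <= (2 * spectral_norm (invmx B))^-1 ->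
  enorm v <= 2 * spectral_norm (invmx B) * enorm (A *m v).
Proof.
move=> uB AB; set b := spectral_norm (invmx B).
have b0 : 0 <= b by exact: spectral_norm_ge0.
have h1 : enorm v <= b * enorm (B *m v).
  by rewrite -[X in enorm X <= _](mulKmx uB) enorm_mulmx.
have h2 : enorm (B *m v) <= enorm (A *m v) + (2 * b)^-1 * enorm v.
  have -> : B *m v = A *m v + (-1) *: ((A - B) *m v).
    by rewrite scaleN1r mulmxBl opprB addrC subrK.
  rewrite (le_trans (enormD _ _))// lerD2l enormZ normrN1 mul1r.
  by rewrite (le_trans (enorm_mulmx _ _))// ler_wpM2r ?enorm_ge0.
(* If [b = 0], the inverse of [2 b] is 0 by convention, but [h1] already forces [|v| <= 0]. *)
have [bE|bn] := eqVneq b 0.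
  by move: h1; rewrite bE !mul0r mulr0 mul0r.
have h3 : b * ((2 * b)^-1 * enorm v) = enorm v / 2 by field.
have := ler_wpM2l b0 h2; rewrite mulrDr h3 => h4.
have := le_trans h1 h4; lra.
Qed.

End euclidean.

(** In positive dimension a vanishing norm would make the nonzero vector [const_mx 1] vanish. *)
Lemma spectral_norm_invmx_gt0 (R : realType) (m : nat) (B : 'M[R]_m.+1) :
  B \in unitmx -> 0 < spectral_norm (invmx B).
Proof.
move=> uB; rewrite lt_def spectral_norm_ge0 andbT; apply/eqP => b0.
have := enorm_mulmx (invmx B) (B *m const_mx 1); rewrite b0 mul0r mulKmx// => h.
have /enorm0_eq0/matrixP/(_ 0 0) : enorm (const_mx 1 : 'cV[R]_m.+1) = 0.
  by apply/eqP; rewrite eq_le h enorm_ge0.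
by rewrite !mxE => /eqP; rewrite oner_eq0.
Qed.

(** * Maximum likelihood *)

Lemma MVT01 (R : realType) (f df : R -> R) :
  (forall t : R, is_derive t 1 f (df t)) ->
  exists2 c, 0 < c < 1 & f 1 - f 0 = df c.
Proof.
move=> dF.
have cf : {within `[0, 1], continuous f}.
  by apply: derivable_within_continuous => t _; have dft := dF t; exact: ex_derive.
have [c c01 h] := @MVT R f df 0 1 ltr01 (fun x _ => dF x) cf.
by exists c; [move: c01; rewrite in_itv|rewrite h subr0 mulr1].
Qed.

Lemma is_derive_line (R : realType) (f df : R -> R) (a x t : R) :
  (forall s : R, is_derive s 1 f (df s)) ->
  is_derive t 1 (fun s => f (a + s * x)) (df (a + t * x) * x).
Proof.
move=> dF.
have h : is_derive t 1 (fun s : R => a + s * x) x.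
  have -> : (fun s : R => a + s * x) = cst a + x *: id.
    by apply/funext => s /=; rewrite mulrC.
  apply: (is_derive_eq (is_deriveD (is_derive_cst _ _ _)
    (is_deriveZ _ (is_derive_id _ _)))).
  by rewrite add0r [_ *: _]mulr1.
exact: (@is_derive1_comp R f (fun s => a + s * x)).
Qed.

Lemma MVT_line (R : realType) (f df : R -> R) (a x : R) :
  (forall s : R, is_derive s 1 f (df s)) ->
  exists2 c, 0 < c < 1 & f (a + x) - f a = df (a + c * x) * x.
Proof.
move=> dF; have [c c01] := MVT01 (fun t => is_derive_line a x t dF).
by rewrite mul1r mul0r addr0 => h; exists c.
Qed.

Lemma taylor1_bound (R : realType) (f df d2f : R -> R) (a x K : R) :
  (forall s : R, is_derive s 1 f (df s)) -> (forall s : R, is_derive s 1 df (d2f s)) ->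
  (forall t, 0 < t < 1 -> `|d2f (a + t * x)| <= K) ->
  `|f (a + x) - f a - df a * x| <= K * x ^+ 2 / 2.
Proof.
move=> h1 h2 hK.
have d1 t : 0 < t < 1 -> `|(df (a + t * x) - df a) * x| <= K * x ^+ 2 * t.
  move=> /andP[t0 t1].
  have [c /andP[c0 c1] ->] := MVT_line a (t * x) h2.
  have hD : `|d2f (a + c * (t * x))| <= K.
    rewrite mulrA; apply: hK; rewrite mulr_gt0//=.
    by rewrite (lt_trans _ t1)// gtr_pMl.
  rewrite (_ : _ * x = d2f (a + c * (t * x)) * (t * x ^+ 2)); last by ring.
  rewrite (_ : K * _ * t = K * (t * x ^+ 2)); last by ring.
  have tx : 0 <= t * x ^+ 2 by rewrite mulr_ge0 ?sqr_ge0// ltW.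
  by rewrite normrM (ger0_norm tx) ler_wpM2r.
have main (e : R) : `|e| = 1 -> e * (f (a + x) - f a - df a * x) <= K * x ^+ 2 / 2.
  move=> e1.
  (* By [d1] this auxiliary function has nonnegative derivative on the open unit interval, and
     [h 1 - h 0] is the slack of the claim; the signs [e = 1] and [e = -1] give the two sides of the
     absolute value. *)
  pose h (t : R) := K * x ^+ 2 / 2 * (t * t) - e * (f (a + t * x) - t * (df a * x)).
  have dh (t : R) : is_derive t 1 h (K * x ^+ 2 * t - e * ((df (a + t * x) - df a) * x)).
    have dl := is_derive_line a x t h1.
    have -> : h = (K * x ^+ 2 / 2) *: (id * id) -
        e *: ((fun s => f (a + s * x)) - (df a * x) *: id).
      by apply/funext => s; rewrite /h /= [s * (df a * x)]mulrC.
    apply: (is_derive_eq (is_deriveB (is_deriveZ _ (is_deriveM (is_derive_id _ _)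
      (is_derive_id _ _)))
      (is_deriveZ _ (is_deriveB dl (is_deriveZ _ (is_derive_id _ _)))))).
    by rewrite /GRing.scale/=; field.
  have [c c01] := MVT01 dh; rewrite /h !mul1r !mul0r addr0 subr0 mulr0 sub0r => hE.
  have : 0 <= K * x ^+ 2 * c - e * ((df (a + c * x) - df a) * x).
    rewrite subr_ge0 (le_trans _ (d1 _ c01))//.
    by rewrite (le_trans (ler_norm _))// normrM e1 mul1r.
  rewrite -hE mulr1; lra.
rewrite ler_norml; apply/andP; split.
  by have := main (-1); rewrite normrN1 => /(_ erefl); lra.
by have := main 1; rewrite normr1 => /(_ erefl); lra.
Qed.

(** Two applications of the mean value theorem write the gap as a positive factor times [(b - a)^2],
    which also settles the equality case. *)
Lemma tangent_below (R : realType) (f df d2f : R -> R) (a b : R) :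
  (forall s : R, is_derive s 1 f (df s)) -> (forall s : R, is_derive s 1 df (d2f s)) ->
  (forall s, 0 < d2f s) -> f a + df a * (b - a) <= f b ?= iff (a == b).
Proof.
move=> h1 h2 d2p.
have [c /andP[c0 c1]] := MVT_line a (b - a) h1; rewrite [a + (b - a)]addrC subrK => hc.
have [c' _] := MVT_line a (c * (b - a)) h2 => hc'.
have E : f b - (f a + df a * (b - a)) = d2f (a + c' * (c * (b - a))) * c * (b - a) ^+ 2.
  rewrite opprD addrA hc -mulrBl hc'; ring.
have dc : 0 < d2f (a + c' * (c * (b - a))) * c by rewrite mulr_gt0.
split.
  by rewrite -subr_ge0 E mulr_ge0 ?sqr_ge0// ltW.
rewrite -subr_eq0 -oppr_eq0 opprB E mulf_eq0 gt_eqF//= sqrf_eq0 subr_eq0 eq_sym.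
by [].
Qed.

(** * The score and uniqueness of the maximizer *)

Section maximum_likelihood.
Variables (R : realType) (n m : nat) (psi dpsi d2psi : R -> R).
Hypothesis dpsiP : forall s : R, is_derive s 1 psi (dpsi s).
Hypothesis d2psiP : forall s : R, is_derive s 1 dpsi (d2psi s).
Hypothesis d2psi_gt0 : forall s, 0 < d2psi s.
Variables (xi : 'I_n -> 'cV[R]_m) (y : n.-tuple R).

(** The derivative of the log-likelihood at [g] in the direction [v]. *)
Definition score (g v : 'cV[R]_m) : R :=
  \sum_(i < n) dotcv (xi i) v * (tnth y i - dpsi (dotcv (xi i) g)).

Lemma scoreZ (g v : 'cV[R]_m) (a : R) : score g (a *: v) = a * score g v.
Proof.
by rewrite /score mulr_sumr; apply: eq_bigr => i _; rewrite dotcvZr mulrA.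
Qed.

Lemma log_likelihood_tangent (g g' : 'cV[R]_m) :
  log_likelihood psi xi y g' <= log_likelihood psi xi y g + score g (g' - g)
    ?= iff [forall i, dotcv (xi i) g == dotcv (xi i) g'].
Proof.
rewrite /log_likelihood /score -big_split/=.
apply: leif_sum => i _.
rewrite dotcvBr.
have [h1 h2] := tangent_below (dotcv (xi i) g) (dotcv (xi i) g') dpsiP d2psiP d2psi_gt0.
split; first by lra.
transitivity (dotcv (xi i) g == dotcv (xi i) g'); last by [].
rewrite -h2 -[LHS]subr_eq0 -[RHS]subr_eq0; congr (_ == 0); ring.
Qed.

Hypothesis xi_separates : forall v, (forall i, dotcv (xi i) v = 0) -> v = 0.

(** By concavity a critical point is a maximizer. Any other maximizer attains equality in the
    tangent bound, so it has the same products with all [xi i] and coincides with [g]. *)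
Lemma score0_unique_mle (g : 'cV[R]_m) : (forall v, score g v = 0) ->
  forall g', is_mle psi xi y g' <-> g' = g.
Proof.
move=> g0 g'.
have mleg : is_mle psi xi y g.
  by move=> g1; have [] := log_likelihood_tangent g g1; rewrite g0 addr0.
split=> [mle'|->//].
have := log_likelihood_tangent g g'; rewrite g0 addr0 => -[le1 eq1].
have : log_likelihood psi xi y g' == log_likelihood psi xi y g.
  by rewrite eq_le le1 mle'.
rewrite eq1 => /forallP h.
apply/eqP; rewrite -subr_eq0; apply/eqP/xi_separates => i.
by rewrite dotcvBr; apply/eqP; rewrite subr_eq0 eq_sym h.
Qed.

Lemma mle_score0 (g : 'cV[R]_m) : is_mle psi xi y g -> forall v, score g v = 0.
Proof.
move=> mleg v.
pose h (t : R) := log_likelihood psi xi y (g + t *: v).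
have dh (t : R) : is_derive t 1 h (score (g + t *: v) v).
  have -> : h = \sum_(i < n) (fun t => (dotcv (xi i) g + t * dotcv (xi i) v) * tnth y i
      - psi (dotcv (xi i) g + t * dotcv (xi i) v)).
    apply/funext => s; rewrite /h /log_likelihood fct_sumE; apply: eq_bigr => i _.
    by rewrite dotcvDr dotcvZr.
  apply: is_derive_sum => i.
  have dl := is_derive_line (dotcv (xi i) g) (dotcv (xi i) v) t dpsiP.
  have -> : (fun t => (dotcv (xi i) g + t * dotcv (xi i) v) * tnth y i
      - psi (dotcv (xi i) g + t * dotcv (xi i) v)) =
     (cst (dotcv (xi i) g * tnth y i) + (dotcv (xi i) v * tnth y i) *: id) -
      (fun s => psi (dotcv (xi i) g + s * dotcv (xi i) v)).
    apply/funext => s.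
    transitivity (dotcv (xi i) g * tnth y i + dotcv (xi i) v * tnth y i * s
      - psi (dotcv (xi i) g + s * dotcv (xi i) v)); [by ring|by []].
  apply: (is_derive_eq (is_deriveB (is_deriveD (is_derive_cst _ _ _)
    (is_deriveZ _ (is_derive_id _ _))) dl)).
  rewrite dotcvDr dotcvZr /GRing.scale/=. ring.
have [] := @derive1_at_max R h (-1) 1 0.
(* The likelihood along the line is maximal at [t = 0], an interior point of []-1, 1[], so its
   derivative vanishes there. *)
- by lra.
- by move=> t _; have dht := dh t; exact: ex_derive.
- by rewrite in_itv/=; apply/andP; split; lra.
- by move=> t _; rewrite /h scale0r addr0; exact: mleg.
move=> _; have dh0 := dh 0; rewrite derive_val scale0r addr0; exact.
Qed.

End maximum_likelihood.

(** * Existence of the maximizer in an ellipsoid around the true parameter *)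

Section mle_existence.
Variables (R : realType) (n m : nat) (psi dpsi d2psi : R -> R).
Hypothesis dpsiP : forall s : R, is_derive s 1 psi (dpsi s).
Hypothesis d2psiP : forall s : R, is_derive s 1 dpsi (d2psi s).
Hypothesis d2psi_gt0 : forall s, 0 < d2psi s.
Variables (xi : 'I_n -> 'cV[R]_m) (y : n.-tuple R) (gamma : 'cV[R]_m).
Variables (w : 'I_n -> R) (C rho : R).

(** When [w i] is the second derivative of [psi] at the [i]-th true parameter, this is minus the
    second derivative of the log-likelihood at [gamma] along [v]. *)
Definition weighted_form (v : 'cV[R]_m) : R := \sum_(i < n) w i * dotcv (xi i) v ^+ 2.

Hypothesis coercive : forall v, dotcv v v <= C * weighted_form v.
Hypothesis C_ge0 : 0 <= C.
Hypothesis rho_gt0 : 0 < rho.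

Lemma weighted_formZ (a : R) v : weighted_form (a *: v) = a ^+ 2 * weighted_form v.
Proof.
rewrite /weighted_form mulr_sumr; apply: eq_bigr => i _.
by rewrite dotcvZr exprMn mulrCA.
Qed.

Lemma weighted_form_separates v : (forall i, dotcv (xi i) v = 0) -> v = 0.
Proof.
move=> v0; apply: dotcv_eq0; apply/eqP; rewrite eq_le dotcv_ge0 andbT.
rewrite (le_trans (coercive v))// /weighted_form big1 ?mulr0// => i _.
by rewrite v0 expr0n mulr0.
Qed.

(** Row vectors are used so that [rV_compact] applies to a surrounding box. *)
Let ball : set 'rV[R]_m := [set r | weighted_form r^T <= rho].

Let ctsM (f g : 'rV[R]_m -> R) : continuous f -> continuous g ->
  continuous (fun r => f r * g r).
Proof. by move=> cf cg r; exact: (@continuousM R _ f g r (cf r) (cg r)). Qed.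

Let continuous_dotcv_trmx (u : 'cV[R]_m) : continuous (fun r : 'rV[R]_m => dotcv u r^T).
Proof.
have -> : (fun r : 'rV[R]_m => dotcv u r^T) = (fun r => \sum_(i < m) u i 0 * r 0 i).
  by apply/funext => r; rewrite dotcvE; apply: eq_bigr => i _; rewrite mxE.
apply: continuous_big => [|i _].
  exact: add_continuous.
by apply: ctsM; [exact: cst_continuous|exact: coord_continuous].
Qed.

Let continuous_weighted_form : continuous (fun r : 'rV[R]_m => weighted_form r^T).
Proof.
have -> : (fun r : 'rV[R]_m => weighted_form r^T) =
    (fun r => \sum_(i < n) w i * (dotcv (xi i) r^T * dotcv (xi i) r^T)).
  by apply/funext => r; apply: eq_bigr => i _; rewrite expr2.
apply: continuous_big => [|i _].
  exact: add_continuous.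
apply: ctsM; first exact: cst_continuous.
by apply: ctsM; exact: continuous_dotcv_trmx.
Qed.

Let continuous_log_likelihood :
  continuous (fun r : 'rV[R]_m => log_likelihood psi xi y (gamma + r^T)).
Proof.
have cpsi : continuous psi.
  move=> x; have dx := dpsiP x.
  by apply/differentiable_continuous/derivable1_diffP; exact: ex_derive.
have cdot i : continuous (fun r : 'rV[R]_m => dotcv (xi i) (gamma + r^T)).
  have -> : (fun r : 'rV[R]_m => dotcv (xi i) (gamma + r^T)) =
      cst (dotcv (xi i) gamma) + (fun r : 'rV[R]_m => dotcv (xi i) r^T).
    by apply/funext => r; rewrite dotcvDr.
  by move=> r; apply: continuousD; [exact: cst_continuous|exact: continuous_dotcv_trmx].
apply: continuous_big => [|i _ r].
  exact: add_continuous.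
have c1 : {for r, continuous (fun r : 'rV[R]_m =>
    dotcv (xi i) (gamma + r^T) * tnth y i)}.
  by apply: (ctsM (cdot i)); exact: cst_continuous.
have c2 : {for r, continuous (psi \o (fun r : 'rV[R]_m => dotcv (xi i) (gamma + r^T)))}.
  exact: (continuous_comp (cdot i r) (cpsi _)).
exact: (continuousB c1 c2).
Qed.

Let compact_ball : compact ball.
Proof.
(* Coordinates satisfy [v_i^2 <= C rho]; adding 1 ensures [b <= b^2], which avoids a square root. *)
pose b := C * rho + 1.
have box : compact [set v : 'rV[R]_m | forall i, v ord0 i \in `[(- b), b]].
  by apply: (@rV_compact _ _ (fun=> `[(- b), b]%classic)) => _; apply: segment_compact.
apply: (subclosed_compact _ box).
  apply: (@preimage_closed _ _ (fun r : 'rV[R]_m => weighted_form r^T) [set x | x <= rho]).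
    by move=> r _; exact: continuous_weighted_form.
  exact: closed_le.
move=> v /= vb i.
have h1 : v 0 i ^+ 2 <= dotcv v^T v^T.
  rewrite dotcvE (bigD1 i)//= !mxE -expr2 lerDl sumr_ge0// => j _.
  by rewrite -expr2 sqr_ge0.
have h2 : v 0 i ^+ 2 <= C * rho.
  by rewrite (le_trans h1)// (le_trans (coercive _))// ler_wpM2l.
have C0 : 0 <= C * rho by rewrite mulr_ge0// ltW.
have b0 : 0 <= b by rewrite addr_ge0.
rewrite in_itv/= -ler_norml -ler_sqr ?nnegrE// real_normK ?num_real//.
rewrite (le_trans h2)// expr2 (@le_trans _ _ b)//; first by rewrite lerDl.
by rewrite ler_peMr// lerDr.
Qed.

(* Concavity makes the likelihood decrease along every ray leaving the ball. *)
Lemma exists_mle :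
  (forall d, weighted_form d = rho -> score dpsi xi y (gamma + d) d < 0) ->
  exists2 g, is_mle psi xi y g & weighted_form (g - gamma) <= rho.
Proof.
move=> sphere.
have ball0 : ball !=set0.
  exists 0; rewrite /ball/= trmx0 -(scale0r 0) weighted_formZ expr0n/= mul0r.
  exact: ltW.
have [c cball cmax] := compact_EVT_max ball0 compact_ball
  (continuous_subspaceT continuous_log_likelihood).
rewrite inE /ball/= in cball.
exists (gamma + c^T); last by rewrite addrC addKr.
move=> g'; rewrite -(subrK gamma g') addrC; set d := g' - gamma.
have inball e : weighted_form e <= rho ->
    log_likelihood psi xi y (gamma + e) <= log_likelihood psi xi y (gamma + c^T).
  move=> eb; have := cmax e^T; rewrite trmxK; apply.
  by rewrite inE /ball/= trmxK.
have [/inball//|dout] := leP (weighted_form d) rho.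
have d0 : 0 < weighted_form d by exact: lt_trans dout.
(* The factor that pulls [d] back to the sphere. The rest of the ray is a nonnegative multiple of
   [s d], so the tangent bound at [gamma + s d] and [sphere] show a decrease. *)
pose s := Num.sqrt (rho / weighted_form d).
have s0 : 0 < s by rewrite sqrtr_gt0 divr_gt0.
have s1 : s <= 1 by rewrite -sqrtr1 ler_wsqrtr// ler_pdivrMr// mul1r ltW.
have qs : weighted_form (s *: d) = rho.
  by rewrite weighted_formZ sqr_sqrtr ?divr_ge0 ?ltW// divfK// gt_eqF.
have [le1 _] := log_likelihood_tangent dpsiP d2psiP d2psi_gt0 xi y
  (gamma + s *: d) (gamma + d).
rewrite (le_trans le1)// (le_trans _ (inball (s *: d) _))// ?qs// gerDl.
have -> : gamma + d - (gamma + s *: d) = ((1 - s) / s) *: (s *: d).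
  rewrite opprD addrACA subrr add0r scalerA divfK ?gt_eqF//.
  by rewrite scalerBl scale1r.
by rewrite scoreZ nmulr_lle0 ?sphere// divr_ge0 ?subr_ge0// ltW.
Qed.

End mle_existence.

(** * Comparison of the maximizer with the linearized estimator *)

Section mle_linearization.
Variables (R : realType) (n m : nat) (psi dpsi d2psi d3psi : R -> R).
Hypothesis dpsiP : forall s : R, is_derive s 1 psi (dpsi s).
Hypothesis d2psiP : forall s : R, is_derive s 1 dpsi (d2psi s).
Hypothesis d3psiP : forall s : R, is_derive s 1 d2psi (d3psi s).
Hypothesis d2psi_gt0 : forall s, 0 < d2psi s.
Variable G1 : R.
Hypothesis d3psi_le : forall s h, `|h| <= 1 -> `|d3psi (s + h)| <= d2psi s * G1.
Variables (xi : 'I_n -> 'cV[R]_m) (y : n.-tuple R) (gamma : 'cV[R]_m).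

Let lam i := dotcv (xi i) gamma.
Let w i := d2psi (lam i).
Let q := weighted_form xi w.

Variables (C rho r : R) (step : 'cV[R]_m).
Hypothesis coercive : forall v, dotcv v v <= C * q v.
Hypothesis C_ge0 : 0 <= C.
Hypothesis rho_gt0 : 0 < rho.
Hypothesis r_le : r <= 1 / 4.
Hypothesis small : forall d, q d <= rho -> forall i,
  `|dotcv (xi i) d| <= 1 /\ G1 * `|dotcv (xi i) d| <= 2 * r.
Hypothesis stepE : forall v,
  \sum_(i < n) w i * (dotcv (xi i) v * dotcv (xi i) step) =
  \sum_(i < n) dotcv (xi i) v * (tnth y i - dpsi (lam i)).
Hypothesis step_le : q step <= rho / 2.

Let rem d i := dpsi (lam i + dotcv (xi i) d) - dpsi (lam i) - w i * dotcv (xi i) d.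

(** Taylor's bound is quadratic in [x]; one factor [G1 |x|] is at most [2 r], which leaves a small
    linear error. *)
Let rem_le d i : q d <= rho -> `|rem d i| <= w i * r * `|dotcv (xi i) d|.
Proof.
move=> /small /(_ i) [x1 xG]; set x := dotcv (xi i) d in x1 xG *.
have bnd t : 0 < t < 1 -> `|d3psi (lam i + t * x)| <= w i * G1.
  move=> /andP[t0 t1]; apply: d3psi_le.
  by rewrite normrM (ger0_norm (ltW t0)) mulr_ile1// ltW.
have := taylor1_bound d2psiP d3psiP bnd; rewrite -[dpsi _ - _ - _]/(rem d i) => h.
rewrite (le_trans h)// -[x ^+ 2]real_normK ?num_real// expr2.
rewrite (_ : _ / 2 = w i * `|x| * (G1 * `|x|) / 2); last by ring.
rewrite (_ : w i * r * `|x| = w i * `|x| * (2 * r) / 2); last by field.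
rewrite ler_wpM2r ?invr_ge0//; apply: ler_wpM2l => //.
by rewrite mulr_ge0// ltW// d2psi_gt0.
Qed.

(** The normal equations [stepE] replace the noise by [step], so the score is linear in [step - d]
    up to [rem]. *)
Let scoreE d v : score dpsi xi y (gamma + d) v =
  \sum_(i < n) dotcv (xi i) v *
    (w i * (dotcv (xi i) step - dotcv (xi i) d) - rem d i).
Proof.
transitivity (\sum_(i < n) dotcv (xi i) v * (tnth y i - dpsi (lam i)) -
    \sum_(i < n) dotcv (xi i) v * (w i * dotcv (xi i) d + rem d i)).
  rewrite /score -sumrB; apply: eq_bigr => i _.
  by rewrite dotcvDr -/(lam i) /rem; ring.
by rewrite -stepE -sumrB; apply: eq_bigr => i _; ring.
Qed.

Let score_sphere d : q d = rho -> score dpsi xi y (gamma + d) d < 0.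
Proof.
move=> qd; rewrite scoreE.
(* Termwise, [x b <= 7/20 x^2 + 5/7 b^2] and the remainder costs at most [x^2 / 4], so [x^2] keeps
   the coefficient [-1 + 7/20 + 1/4 = -2/5]. On the sphere the total is at most
   [(-2/5 + 5/14) rho < 0]. *)
apply: (@le_lt_trans _ _ (\sum_(i < n) (- (2 / 5) * (w i * dotcv (xi i) d ^+ 2) +
    5 / 7 * (w i * dotcv (xi i) step ^+ 2)))); last first.
  rewrite big_split/= -!mulr_sumr -/(weighted_form xi w d) -/(weighted_form xi w step) -/q.
  by move: step_le rho_gt0; rewrite qd; lra.
apply: ler_sum => i _.
have rl : `|rem d i| <= w i * r * `|dotcv (xi i) d| by apply: rem_le; rewrite qd.
set x := dotcv (xi i) d in rl *; set b := dotcv (xi i) step.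
have w0 : 0 <= w i by rewrite ltW// d2psi_gt0.
have h1 : - (x * rem d i) <= w i * x ^+ 2 / 4.
  rewrite (le_trans (ler_norm _))// normrN normrM.
  rewrite (le_trans (ler_wpM2l (normr_ge0 _) rl))//.
  rewrite [leLHS](_ : _ = w i * (`|x| ^+ 2) * r); last by ring.
  rewrite real_normK ?num_real//; apply: ler_wpM2l.
    by rewrite mulr_ge0 ?sqr_ge0.
  by rewrite -[4^-1]mul1r.
have h2 : 0 <= w i * (7 / 10 * x - b) ^+ 2 by rewrite mulr_ge0 ?sqr_ge0.
rewrite -subr_ge0.
rewrite (_ : _ - _ = 5 / 7 * (w i * (7 / 10 * x - b) ^+ 2) +
   (w i * x ^+ 2 / 4 - (- (x * rem d i)))); last by field.
by rewrite addr_ge0 ?subr_ge0// mulr_ge0.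
Qed.

Lemma mle_near_step : exists g,
  (forall g', is_mle psi xi y g' <-> g' = g) /\ q (step - (g - gamma)) <= r ^+ 2 * rho.
Proof.
have [g mleg gball] := exists_mle dpsiP d2psiP d2psi_gt0 coercive C_ge0 rho_gt0 score_sphere.
have g0 := mle_score0 dpsiP mleg.
exists g; split.
  exact: (score0_unique_mle dpsiP d2psiP d2psi_gt0 (weighted_form_separates coercive)).
set d := g - gamma in gball *; set v := step - d.
have : score dpsi xi y (gamma + d) v = 0 by rewrite addrC subrK.
rewrite scoreE => sv.
(* The vanishing score in the direction [v] says that [q v] is the sum of the products of
   [dotcv (xi i) v] and [rem d i]. By [rem_le] and the inequality between means this is at most
   [q v / 2 + r^2 q d / 2], and the first half is absorbed. *)
have h : q v <= \sum_(i < n) (1 / 2 * (w i * dotcv (xi i) v ^+ 2) +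
    r ^+ 2 / 2 * (w i * dotcv (xi i) d ^+ 2)).
  have -> : q v = q v - \sum_(i < n) dotcv (xi i) v *
      (w i * (dotcv (xi i) step - dotcv (xi i) d) - rem d i) by rewrite sv subr0.
  rewrite /q /weighted_form -sumrB; apply: ler_sum => i _.
  have := rem_le i gball; rewrite -dotcvBr -/v.
  set a := dotcv (xi i) v; set x := dotcv (xi i) d => rl.
  rewrite (_ : _ - _ = a * rem d i); last by ring.
  rewrite (le_trans (ler_norm _))// normrM.
  rewrite (le_trans (ler_wpM2l (normr_ge0 _) rl))//.
  rewrite -[a ^+ 2]real_normK ?num_real// -[x ^+ 2]real_normK ?num_real//.
  have : 0 <= w i * (`|a| - r * `|x|) ^+ 2 by rewrite mulr_ge0 ?sqr_ge0// ltW// d2psi_gt0.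
  move=> h; rewrite -subr_ge0.
  rewrite [X in 0 <= X](_ : _ = w i * (`|a| - r * `|x|) ^+ 2 / 2); last by field.
  by rewrite divr_ge0.
move: h; rewrite big_split/= -!mulr_sumr.
rewrite -/(weighted_form xi w v) -/(weighted_form xi w d) -/q => h.
have h2 : r ^+ 2 * q d <= r ^+ 2 * rho by rewrite ler_wpM2l ?sqr_ge0.
rewrite (le_trans _ h2)//; lra.
Qed.

End mle_linearization.

(** * The information matrix *)

Section information_matrix.
Variables (R : realType) (n m : nat) (psi : R -> R).
Variables (eta : 'I_n -> 'cV[R]_m) (lambda : 'I_n -> R).
Hypothesis psi2_ge0 : forall i, 0 <= derive1n 2 psi (lambda i).
Let A := information_mx psi eta lambda.

Lemma dotcv_information_mx u v : dotcv u (A *m v) =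
  n%:R^-1 * \sum_(i < n) derive1n 2 psi (lambda i) *
     (dotcv (eta i) u * dotcv (eta i) v).
Proof.
rewrite /A /information_mx -scalemxAl dotcvZr mulmx_suml dotcv_sumr; congr (_ * _).
apply: eq_bigr => i _; rewrite -scalemxAl dotcvZr; congr (_ * _).
by rewrite /dotcv mulmxA mulmxA -mulmxA -/(dotcv _ _) mxE big_ord1 -!/(dotcv _ _) (dotcvC u).
Qed.

Lemma trmx_information_mx : A^T = A.
Proof.
rewrite /A /information_mx linearZ/= linear_sum/=; congr (_ *: _).
by apply: eq_bigr => i _; rewrite linearZ/= trmx_mul trmxK.
Qed.

Lemma information_mx_psd v : 0 <= dotcv v (A *m v).
Proof.
rewrite dotcv_information_mx mulr_ge0 ?invr_ge0 ?ler0n// sumr_ge0// => i _.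
by rewrite mulr_ge0// -expr2 sqr_ge0.
Qed.

(** Cyclicity of the trace turns the left side into the trace of [invmx A *m A]. It is the expected
    squared norm of the linearized estimator, up to scaling. *)
Lemma information_mx_trace : A \in unitmx ->
  \sum_(i < n) n%:R^-1 * dotcv (eta i) (invmx A *m eta i) * derive1n 2 psi (lambda i) = m%:R.
Proof.
move=> uA; rewrite -[RHS](mxtrace1 R m) -(mulVmx uA).
rewrite [in RHS]/A /information_mx -scalemxAr mxtraceZ mulmx_sumr raddf_sum/= mulr_sumr.
apply: eq_bigr => i _; rewrite -scalemxAr mxtraceZ mulmxA mxtrace_mulC.
by rewrite /mxtrace big_ord1 -/(dotcv _ _); ring.
Qed.

End information_matrix.

(** * The deviation bound for the maximum likelihood estimator *)

Theorem lemma1 (R : realType)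
    (Q : R -> probability (measurableTypeR R) R) (psi : R -> R)
    (hQ : exponential_family Q psi)
    (hpsi2 : forall lambda : R, 0 < derive1n 2 psi lambda)
    (G : R -> R)
    (hG_incr : forall s t : R, 0 <= s -> s <= t -> G s <= G t)
    (hG0 : 1 <= G 0)
    (hG : forall lambda h : R,
        `|derive1n 3 psi (lambda + h)| <= derive1n 2 psi lambda * G `|h|)
    (n N : nat) (xi : 'I_n -> 'cV[R]_N.+1) (gamma : 'cV[R]_N.+1)
    (lambda : 'I_n -> R)
    (hlambda : forall i, lambda i = dotcv (xi i) gamma)
    (QQ : probability (n.-tuple (measurableTypeR R)) R)
    (hQQ : is_product_measure (fun i => Q (lambda i)) QQ)
    (ghat : n.-tuple R -> 'cV[R]_N.+1)
    (hghat : forall y : n.-tuple R,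
        (exists g, is_mle psi xi y g) -> is_mle psi xi y (ghat y))
    (D : 'M[R]_N.+1) (hD : D \in unitmx)
    (eta : 'I_n -> 'cV[R]_N.+1) (hxi : forall i, xi i = D *m eta i)
    (A B : 'M[R]_N.+1)
    (hA : A = information_mx psi eta lambda)
    (hB : B \in unitmx)
    (hAB : spectral_norm (A - B) <= (2 * spectral_norm (invmx B))^-1)
    (eps : R) (heps0 : 0 < eps) (heps1 : eps < 1)
    (heta : forall i, enorm (eta i) <=
        (eps * Num.sqrt n%:R / N.+1%:R)
          / (G 1 * Num.sqrt (32 * spectral_norm (invmx B))))
    (M : nat) (kappa : 'I_M.+1 -> 'cV[R]_N.+1) :
  exists Y : set (n.-tuple (measurableTypeR R)),
    [/\ measurable Y,
        (QQ (~` Y) < (2 * eps)%:E)%E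
      & forall y, Y y ->
          (forall g, is_mle psi xi y g <-> g = ghat y) /\
          \sum_(j < M.+1) dotcv (kappa j) (ghat y - gamma) ^+ 2 <=
            6 * spectral_norm (invmx B) / (n%:R * eps)
              * \sum_(j < M.+1) enorm (invmx D *m kappa j) ^+ 2].
Proof.
subst A; set A := information_mx psi eta lambda in hAB.
set b := spectral_norm (invmx B) in hAB heta *.
have b0 : 0 < b by exact: spectral_norm_invmx_gt0.
have coerA v : enorm v <= 2 * b * enorm (A *m v) by exact: perturbed_coercive.
(* For [n = 0] the matrix [A] would vanish, contradicting coercivity in positive dimension. *)
have n0 : (0 < n)%N.
  rewrite lt0n; apply/eqP => nz.
  have nz0 : n%:R = 0 :> R by rewrite nz.
  have A0 : A = 0 by rewrite /A /information_mx nz0 invr0 scale0r.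
  have := coerA (const_mx 1).
  rewrite A0 mul0mx [enorm 0]enorm_dotcv dotcv0r sqrtr0 mulr0 => h.
  have /enorm0_eq0/matrixP/(_ 0 0) : enorm (const_mx 1 : 'cV[R]_N.+1) = 0.
    by apply/eqP; rewrite eq_le h enorm_ge0.
  by rewrite !mxE => /eqP; rewrite oner_eq0.
have nR : 0 < n%:R :> R by rewrite ltr0n.
have w0 i : 0 <= derive1n 2 psi (lambda i) by rewrite ltW.
have symA : A^T = A by exact: trmx_information_mx.
have psdA v : 0 <= dotcv v (A *m v) by exact: information_mx_psd.
have b2 : 0 <= 2 * b by rewrite mulr_ge0// ltW.
have uA : A \in unitmx by exact: sym_coercive_unitmx symA coerA.
have pdA v : dotcv v v <= 2 * b * dotcv v (A *m v) by exact: psd_coercive.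
have xiE i v : dotcv (xi i) v = dotcv (eta i) (D^T *m v).
  by rewrite hxi dotcvC dotcv_mulmxr dotcvC.
have uDT : D^T \in unitmx by rewrite unitmx_tr.
have dpsiP (s : R) : is_derive s 1 psi (derive1 psi s).
  by rewrite (derive1_cumulant hQ); exact: is_derive_cumulant.
have d2psiP (s : R) : is_derive s 1 (derive1 psi) (derive1n 2 psi s).
  rewrite derive1nS derive1n1 derive1E; apply: derivableP.
  exact: (derivable_cumulant2 hQ).
have d3psiP (s : R) : is_derive s 1 (derive1n 2 psi) (derive1n 3 psi s).
  rewrite [derive1n 3 psi]derive1nS derive1E; apply: derivableP.
  exact: (derivable_cumulant3 hQ).
have G1 : 1 <= G 1 by rewrite (le_trans hG0)// hG_incr.
have d3psi_le (s h : R) : `|h| <= 1 ->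
    `|derive1n 3 psi (s + h)| <= derive1n 2 psi s * G 1.
  move=> h1; rewrite (le_trans (hG s h))// ler_wpM2l// ?hG_incr// ltW//.
pose w i := derive1n 2 psi (dotcv (xi i) gamma).
pose q := weighted_form xi w.
have qE v : q v = n%:R * dotcv (D^T *m v) (A *m (D^T *m v)).
  rewrite dotcv_information_mx mulrA divff ?gt_eqF// mul1r; apply: eq_bigr => i _.
  by rewrite /w -hlambda xiE expr2.
have coerq v : dotcv (D^T *m v) (D^T *m v) <= 2 * b / n%:R * q v.
  rewrite qE mulrA divfK ?gt_eqF//.
(* A crude constant suffices for coercivity in the original coordinates: it gives compactness and
   separation and does not enter the final bound, which uses [coerq]. *)
pose S := spectral_norm (invmx D^T).
have coer v : dotcv v v <= S ^+ 2 * (2 * b / n%:R) * q v.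
  rewrite -mulrA (le_trans _ (ler_wpM2l _ (coerq v))) ?sqr_ge0//.
  rewrite -!enorm_sqr -exprMn lerXn2r ?nnegrE ?mulr_ge0 ?enorm_ge0 ?spectral_norm_ge0//.
  by rewrite -{1}(mulKmx uDT v) enorm_mulmx.
(* [q] is [n] times the [A]-form, so that [rho] is [n r0^2]. *)
pose rho : R := 4 * N.+1%:R / eps.
have N0 : 0 < N.+1%:R :> R by rewrite ltr0n.
have rho0 : 0 < rho by rewrite divr_gt0// mulr_gt0.
have eN : eps <= N.+1%:R.
  apply: (le_trans (ltW heps1)); rewrite ler1n//.
pose r : R := Num.sqrt (eps / N.+1%:R) / 4.
have r2 : r ^+ 2 = eps / N.+1%:R / 16.
  rewrite /r expr_div_n sqr_sqrtr ?divr_ge0 ?ltW//; congr (_ / _).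
  by rewrite -natrX.
have r0 : 0 <= r by rewrite divr_ge0// sqrtr_ge0.
have r_le : r <= 1 / 4.
  have e1 : eps / N.+1%:R <= 1 by rewrite ler_pdivrMr// mul1r.
  by rewrite ler_wpM2r ?invr_ge0// -[leRHS]sqrtr1 ler_wsqrtr.
clearbody r.
have G10 : 0 < G 1 by exact: lt_le_trans G1.
have small d : q d <= rho -> forall i,
    `|dotcv (xi i) d| <= 1 /\ G 1 * `|dotcv (xi i) d| <= 2 * r.
  move=> qd i.
  have e2 : dotcv (eta i) (eta i) <=
      eps ^+ 2 * n%:R / N.+1%:R ^+ 2 / (G 1 ^+ 2 * (32 * b)).
    rewrite -enorm_sqr (_ : _ / (_ * (32 * b)) = ((eps * Num.sqrt n%:R / N.+1%:R)
      / (G 1 * Num.sqrt (32 * b))) ^+ 2).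
      by rewrite lerXn2r ?nnegrE ?enorm_ge0// (le_trans (enorm_ge0 _) (heta i)).
    by rewrite !expr_div_n !exprMn !sqr_sqrtr ?mulr_ge0 ?ltW.
  have u2 : dotcv (D^T *m d) (D^T *m d) <= 2 * b / n%:R * rho.
    by rewrite (le_trans (coerq d))// ler_wpM2l// divr_ge0.
  (* The product of the bounds [e2] and [u2] is exactly [eps / (4 N_+ (G 1)^2)]; the 32 in the
     hypothesis on [eta] matches the 16 in [r2]. *)
  have x2 : dotcv (xi i) d ^+ 2 <= (2 * r / G 1) ^+ 2.
    rewrite xiE (le_trans (cauchy_schwarz _ _))//.
    rewrite (le_trans (ler_pM (dotcv_ge0 _) (dotcv_ge0 _) e2 u2))//.
    rewrite !exprMn exprVn r2 /rho le_eqVlt; apply/orP; left; apply/eqP.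
    by field; rewrite !gt_eqF.
  have hx : G 1 * `|dotcv (xi i) d| <= 2 * r.
    rewrite mulrC -ler_pdivlMr// -ler_sqr ?nnegrE//; last first.
      by rewrite divr_ge0 ?mulr_ge0// ltW.
    by rewrite real_normK ?num_real.
  split=> //; rewrite (le_trans (ler_peMl (normr_ge0 _) G1))// (le_trans hx)//; lra.
pose mu i := derive1 psi (lambda i).
pose Z (y : n.-tuple R) := \sum_(i < n) (tnth y i - mu i) *: eta i.
(* [dl] is the linearized estimator in the coordinates [D^T *m v]; [step] is the same vector in the
   original coordinates. *)
pose dl y := invmx A *m (n%:R^-1 *: Z y).
pose step y := invmx D^T *m dl y.
have stepE y v : \sum_(i < n) w i * (dotcv (xi i) v * dotcv (xi i) (step y)) =
    \sum_(i < n) dotcv (xi i) v * (tnth y i - derive1 psi (dotcv (xi i) gamma)).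
  transitivity (n%:R * dotcv (D^T *m v) (A *m (D^T *m step y))).
    rewrite dotcv_information_mx mulrA divff ?gt_eqF// mul1r; apply: eq_bigr => i _.
    by rewrite /w -hlambda !xiE.
  rewrite /step mulKVmx// /dl mulKVmx// dotcvZr mulrA divff ?gt_eqF// mul1r /Z dotcv_sumr.
  by apply: eq_bigr => i _; rewrite dotcvZr mulrC (xiE i v) /mu hlambda dotcvC.
pose c1 i l := n%:R^-1 * dotcv (eta i) (invmx A *m eta l).
pose kap j := invmx D *m kappa j.
pose a j i := n%:R^-1 * dotcv (kap j) (invmx A *m eta i).
pose c2 i l := \sum_(j < M.+1) a j i * a j l.
pose X1 y := q (step y).
pose X2 y := \sum_(j < M.+1) dotcv (kappa j) (step y) ^+ 2.
have X1E : X1 = centered_form mu c1.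
  apply/funext => y; rewrite /X1 qE /step mulKVmx// [in X in _ * X]/dl mulKVmx//.
  rewrite dotcvZr mulrA divff ?gt_eqF// mul1r dotcvC /dl -scalemxAr dotcvZr.
  rewrite [X in dotcv _ (_ *m X)]/Z mulmx_sumr dotcv_sumr mulr_sumr.
  rewrite /centered_form exchange_big/=.
  apply: eq_bigr => l _; rewrite -scalemxAr dotcvZr /Z dotcvC dotcv_sumr !mulr_sumr.
  by apply: eq_bigr => i _; rewrite dotcvZr /c1 (dotcvC (eta i)); ring.
have kstep y j : dotcv (kappa j) (step y) = \sum_(i < n) a j i * (tnth y i - mu i).
  rewrite /step dotcv_mulmxr trmx_inv trmxK -/(kap j) /dl -scalemxAr dotcvZr /Z.
  rewrite mulmx_sumr dotcv_sumr mulr_sumr; apply: eq_bigr => i _.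
  by rewrite -scalemxAr dotcvZr /a; ring.
have X2E : X2 = centered_form mu c2.
  apply/funext => y; rewrite /X2 /centered_form /c2.
  transitivity (\sum_(j < M.+1) \sum_(i < n) \sum_(l < n)
     a j i * a j l * ((tnth y i - mu i) * (tnth y l - mu l))).
    apply: eq_bigr => j _; rewrite expr2 kstep mulr_suml; apply: eq_bigr => i _.
    by rewrite mulr_sumr; apply: eq_bigr => l _; ring.
  rewrite exchange_big/=; apply: eq_bigr => i _; rewrite exchange_big/=.
  by apply: eq_bigr => l _; rewrite mulr_suml.
have EX1 : \sum_(i < n) c1 i i * derive1n 2 psi (lambda i) = N.+1%:R.
  exact: information_mx_trace.
pose Sk := \sum_(j < M.+1) enorm (kap j) ^+ 2.
(* With [z = invmx A *m kap j], the [j]-th contribution is [z'Az / n], that is [z' (kap j) / n], and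
   coercivity bounds [|z|] by [2 b |kap j|]. *)
have EX2 : \sum_(i < n) c2 i i * derive1n 2 psi (lambda i) <= 2 * b / n%:R * Sk.
  rewrite /c2 (eq_bigr (fun i =>
      \sum_(j < M.+1) a j i * a j i * derive1n 2 psi (lambda i))).
    rewrite exchange_big mulr_sumr; apply: ler_sum => j _.
    pose z := invmx A *m kap j.
    have az i : a j i = n%:R^-1 * dotcv (eta i) z.
      by rewrite /a dotcv_mulmxr trmx_inv symA dotcvC.
    rewrite (_ : \sum_(i < n) _ = n%:R^-1 * dotcv z (A *m z)); last first.
      rewrite dotcv_information_mx !mulr_sumr; apply: eq_bigr => i _.
      by rewrite !az; ring.
    rewrite mulrAC [leRHS]mulrC ler_wpM2l ?invr_ge0 ?(ltW nR)//.
    rewrite /z mulKVmx// (le_trans (dotcv_le_enorm _ _))// expr2 mulrA.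
    rewrite ler_wpM2r ?enorm_ge0// (le_trans (coerA _))// mulKVmx//.
  by move=> i _; rewrite mulr_suml.
have cP i := expfam_integrable_centered hQ (lambda i).
have meanP i := expfam_mean hQ (lambda i).
have vP i := expfam_integrable_centered_sqr hQ (lambda i).
have varP i := expfam_variance hQ (lambda i).
have mform c : measurable_fun setT
    (centered_form mu c : n.-tuple (measurableTypeR R) -> R).
  apply/measurable_EFinP; apply: measurable_int.
  exact: (integrable_centered_form hQQ cP vP c).
have Eform c := integral_centered_form hQQ cP meanP vP varP c.
have q_ge0 v : 0 <= q v by rewrite qE mulr_ge0 ?psdA// ltW.
have X2_ge0 y : 0 <= X2 y by apply: sumr_ge0 => j _; rewrite sqr_ge0.
have Sk_ge0 : 0 <= Sk by apply: sumr_ge0 => j _; rewrite sqr_ge0.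
(* [a1] is [2 / eps] times the mean of [X1], and [a2] is [1 / eps] times the bound on the mean of
   [X2]. The exceptional probabilities [eps / 2] and [eps] leave room for the strict inequality with
   [2 eps]. *)
pose a1 := rho / 2; pose a2 := 2 * b / (n%:R * eps) * Sk.
have mX1 : measurable_fun setT (X1 : n.-tuple (measurableTypeR R) -> R) by rewrite X1E.
have mX2 : measurable_fun setT (X2 : n.-tuple (measurableTypeR R) -> R) by rewrite X2E.
pose B1 := [set y : n.-tuple (measurableTypeR R) | a1 < X1 y].
pose B2 := [set y : n.-tuple (measurableTypeR R) | a2 < X2 y].
have mB1 : measurable B1 by exact: measurable_superlevel.
have mB2 : measurable B2 by exact: measurable_superlevel.
have PB1 : (QQ B1 <= (eps / 2)%:E)%E.
  rewrite (_ : eps / 2 = N.+1%:R / a1); last first.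
    by rewrite /a1 /rho; field; rewrite !gt_eqF.
  apply: (markov_ge0 mX1) => [y||]; [exact: q_ge0| |by rewrite divr_gt0].
  by rewrite X1E Eform EX1.
have PB2 : (QQ B2 <= eps%:E)%E.
  (* If [Sk = 0] the threshold is zero and Markov's inequality does not apply, but then every
     [kap j] vanishes and [X2] is identically zero. *)
  have [Sk0|Sk0] := eqVneq Sk 0.
    rewrite (_ : B2 = set0) ?measure0 ?lee_fin ?ltW//.
    rewrite -subset0 => y; rewrite /B2/= /a2 Sk0 mulr0 ltNge => /negP; apply.
    rewrite /X2 big1// => j _; rewrite kstep big1 ?expr0n// => i _.
    move/eqP: Sk0; rewrite psumr_eq0 => [|k _]; last by rewrite sqr_ge0.
    move=> /allP/(_ j (mem_index_enum _)); rewrite /= sqrf_eq0 => /eqP/enorm0_eq0 kj0.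
    by rewrite /a kj0 dotcvC dotcv0r mulr0 mul0r.
  have Skp : 0 < Sk by rewrite lt_def Sk0.
  have a2p : 0 < a2 by rewrite mulr_gt0// divr_gt0// mulr_gt0.
  rewrite (_ : eps = 2 * b / n%:R * Sk / a2); last first.
    by rewrite /a2; field; rewrite !gt_eqF.
  apply: (markov_ge0 mX2) => //.
  by rewrite X2E Eform lee_fin.
exists (~` (B1 `|` B2)); split.
- by apply: measurableC; exact: measurableU.
- rewrite setCK (le_lt_trans (measureU2 _ mB1 mB2))//.
  rewrite (le_lt_trans (leeD PB1 PB2))// -EFinD lte_fin; lra.
- move=> y /not_orP[/negP yB1 /negP yB2].
  have X1y : q (step y) <= rho / 2 by rewrite leNgt.
  have X2y : X2 y <= a2 by rewrite leNgt.
  have [g [gmle gnear]] := mle_near_step dpsiP d2psiP d3psiP hpsi2 d3psi_le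
    coer (mulr_ge0 (sqr_ge0 _) (divr_ge0 b2 (ltW nR))) rho0 r_le small (stepE y) X1y.
  (* A maximizer exists at this [y], so [ghat y] is one, and uniqueness identifies it with [g]. *)
  have gE : ghat y = g by apply/gmle/hghat; exists g; exact/gmle.
  split; first by rewrite gE.
  rewrite gE.
  (* Here [r^2 rho = 1/4], so [coerq] bounds the squared distance to the step by [(2 b / n) / 4]. *)
  have near j : dotcv (kappa j) (step y - (g - gamma)) ^+ 2 <=
      enorm (kap j) ^+ 2 * (b / (2 * n%:R)).
    set v := step y - (g - gamma) in gnear *.
    have -> : dotcv (kappa j) v = dotcv (kap j) (D^T *m v).
      by rewrite dotcv_mulmxr trmxK /kap mulKVmx.
    rewrite (le_trans (cauchy_schwarz _ _))// enorm_sqr ler_wpM2l ?dotcv_ge0//.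
    rewrite (le_trans (coerq v))//.
    rewrite (le_trans (ler_wpM2l (divr_ge0 b2 (ltW nR)) gnear))// r2 /rho.
    rewrite le_eqVlt; apply/orP; left; apply/eqP.
    by field; rewrite !gt_eqF.
  have : \sum_(j < M.+1) dotcv (kappa j) (g - gamma) ^+ 2 <=
      2 * X2 y + 2 * (Sk * (b / (2 * n%:R))).
    rewrite /X2 /Sk mulr_suml !mulr_sumr -big_split/=; apply: ler_sum => j _.
    have := near j; rewrite (dotcvBr _ (step y)).
    set s := dotcv _ (step y); set t := dotcv _ (g - gamma) => st.
    have : 0 <= (2 * s - t) ^+ 2 by rewrite sqr_ge0.
    rewrite (_ : (2 * s - t) ^+ 2 = 2 * s ^+ 2 + 2 * (s - t) ^+ 2 - t ^+ 2); last by ring.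
    lra.
  move=> /le_trans; apply.
  (* The target is [3 a2]: the step contributes at most [2 a2] and, since [eps < 1], the
     linearization error at most [a2 / 2]. *)
  rewrite -/Sk (_ : 6 * b / _ * _ = 3 * a2); last first.
    by rewrite /a2; field; rewrite !gt_eqF.
  have : Sk * (b / (2 * n%:R)) <= a2 / 4.
    rewrite (_ : a2 / 4 = Sk * (b / (2 * n%:R)) / eps); last first.
      by rewrite /a2; field; rewrite !gt_eqF.
    by rewrite ler_pdivlMr// ler_piMr ?mulr_ge0 ?divr_ge0 ?mulr_ge0// ltW.
  have a2_ge0 : 0 <= a2 by exact: le_trans X2y.
  lra.
Qed.
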